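(* Fix $k\ge 2$ in the definition of $\phi^*$. For every rook placement $P$ on a Ferrers board $F$, $$\phi^*(P')=(\phi^*(P))',$$ where $'$ denotes the inverse of a placement.
   Context: Boards and placements. In an $n\times n$ array of squares, $(i,j)$ denotes the square in the $i$th column from the left and the $j$th row from the bottom; $R(i,j)$ is the rectangle of all squares $(k',\ell')$ with $k'\le i$, $\ell'\le j$. A Ferrers board is a subset $F$ of such an array such that $(i,j)\in F$ implies $R(i,j)\subseteq F$. A rook placement $P$ on $F$ is a subset of $F$ with at most one square in each row and at most one square in each column (not necessarily full). The conjugate board is $F'=\{(j,i):(i,j)\in F\}$ and the inverse of a placement $P$ on $F$ is the placement $P'=\{(j,i):(i,j)\in P\}$ on $F'$. The map $\phi^*$. An occurrence of $k\ldots 1$ in a placement $P$ on $F$ is a sequence of squares $(i_1,\pi_{1}),\ldots,(i_k,\pi_{k})$ of $P$ with $i_1<\cdots<i_k$ and $\pi_1>\cdots>\pi_k$, all contained in a common rectangular subboard of $F$ (equivalently $(i_k,\pi_1)\in F$). Order the occurrences lexicographically by their row sequences $(\pi_1,\ldots,\pi_k)$. If $P$ has an occurrence of $k\ldots1$, $\phi(P)$ is obtained from $P$ by taking the smallest occurrence and replacing its squares by $(i_1,\pi_2),(i_2,\pi_3),\ldots,(i_{k-1},\pi_k),(i_k,\pi_1)$, leaving all other squares of $P$ unchanged. $\phi^*(P)$ is obtained by applying $\phi$ repeatedly until no occurrence of $k\ldots 1$ remains (so $\phi^*(P)=P$ if there is none). *)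

(* Defs.v *)
From HB Require Import structures.
From mathcomp Require Import all_boot all_order.
From mathcomp Require Import zify.

Set Implicit Arguments.
Unset Strict Implicit.
Unset Printing Implicit Defensive.

(* The square (i, j) lies in column i (counted from the left) and row j
   (counted from the bottom); both coordinates start at 0. *)
Notation square n := ('I_n * 'I_n)%type.

Definition ferrers n (F : {set square n}) : Prop :=
  forall x y : square n, x \in F -> y.1 <= x.1 -> y.2 <= x.2 -> y \in F.

(* The rectangle with lower left corner a and upper right corner b. *)
Definition rect n (a b : square n) : {set square n} :=
  [set x : square n | (a.1 <= x.1 <= b.1) && (a.2 <= x.2 <= b.2)].

Definition is_placement n (F P : {set square n}) : bool :=
  [&& P \subset F,
      [forall i : 'I_n, #|[set x in P | x.1 == i]| <= 1] &
      [forall j : 'I_n, #|[set x in P | x.2 == j]| <= 1]].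

Record placement n (F : {set square n}) := Placement {
  squares :> {set square n};
  placementP : is_placement F squares }.
HB.instance Definition _ n (F : {set square n}) :=
  [isSub for @squares n F].

Definition transpose n (A : {set square n}) : {set square n} :=
  [set (x.2, x.1) | x in A].

Section Phi.

Variables (n k : nat).
Implicit Types (F P : {set square n}) (s t : k.-tuple (square n)).

Definition cols (s : seq (square n)) : seq 'I_n := [seq x.1 | x <- s].
Definition rows (s : seq (square n)) : seq 'I_n := [seq x.2 | x <- s].

(* An occurrence of k ... 1, listed from left to right; it has to fit in a
   rectangle contained in the board. *)
Definition occurrence F P s : bool :=
  [&& all (fun x => x \in P) s,
      sorted (fun x y : square n => (x.1 < y.1) && (y.2 < x.2)) s &
      [exists a : square n, exists b : square n,
        (rect a b \subset F) && all (fun x => x \in rect a b) s]].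

Definition has_occurrence F P : bool :=
  [exists s : k.-tuple (square n), occurrence F P s].

Definition row_word (s : seq (square n)) : seqlexi nat :=
  [seq val j | j <- rows s].

(* In a placement an occurrence is determined by its row sequence, so at most
   one s qualifies. *)
Definition smallest_occurrence F P s : bool :=
  occurrence F P s &&
  [forall t : k.-tuple (square n),
     occurrence F P t ==> (row_word s <= row_word t)%O].

(* (i_1, p_1), ..., (i_k, p_k) becomes
   (i_1, p_2), ..., (i_{k-1}, p_k), (i_k, p_1). *)
Definition cycle_rows (s : seq (square n)) : seq (square n) :=
  zip (cols s) (rot 1 (rows s)).

Definition phi_set F P : {set square n} :=
  if [pick s | smallest_occurrence F P s] is Some s
  then (P :\: [set x in tval s]) :|: [set x in cycle_rows s]
  else P.

End Phi.

Section Transpose.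

Variable n : nat.
Implicit Types (F P : {set square n}).

Lemma mem_transpose P (x : square n) : (x \in transpose P) = ((x.2, x.1) \in P).
Proof.
apply/imsetP/idP => [[[a b] abP ->] //|xP].
by exists (x.2, x.1) => //; case: x {xP}.
Qed.

Lemma ferrers_transpose F : ferrers F -> ferrers (transpose F).
Proof.
move=> hF x y; rewrite !mem_transpose => xF h1 h2.
exact: (hF _ (y.2, y.1) xF).
Qed.

Lemma is_placementP F P :
  reflect [/\ P \subset F,
              {in P &, injective (fun x : square n => x.1)} &
              {in P &, injective (fun x : square n => x.2)}]
          (is_placement F P).
Proof.
apply: (iffP and3P) => -[PF h1 h2]; split=> //.
- move=> x y xP yP exy; have /card_le1_eqP := forallP h1 x.1.
  by apply; rewrite inE ?xP ?yP ?exy /=.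
- move=> x y xP yP exy; have /card_le1_eqP := forallP h2 x.2.
  by apply; rewrite inE ?xP ?yP ?exy /=.
- apply/forallP => i; apply/card_le1_eqP => x y.
  rewrite !inE => /andP[xP /eqP xi] /andP[yP /eqP yi].
  by apply: h1 => //; rewrite xi yi.
- apply/forallP => i; apply/card_le1_eqP => x y.
  rewrite !inE => /andP[xP /eqP xi] /andP[yP /eqP yi].
  by apply: h2 => //; rewrite xi yi.
Qed.

Lemma is_placement_transpose F P :
  is_placement F P -> is_placement (transpose F) (transpose P).
Proof.
move=> /is_placementP[PF h1 h2]; apply/is_placementP; split.
- by apply/subsetP=> x; rewrite !mem_transpose; apply: (subsetP PF).
- move=> [a b] [c d]; rewrite !mem_transpose /= => xP yP e.
  by case: (h2 _ _ xP yP e) => -> ->.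
- move=> [a b] [c d]; rewrite !mem_transpose /= => xP yP e.
  by case: (h1 _ _ xP yP e) => -> ->.
Qed.

Definition inverse F (P : placement F) : placement (transpose F) :=
  Placement (is_placement_transpose (placementP P)).

End Transpose.

Section PhiPlacement.

Variables (n k : nat).
Implicit Types (F P : {set square n}) (s t : k.-tuple (square n)).

Let r (x y : square n) := (x.1 < y.1) && (y.2 < x.2).

Let r_trans : transitive r.
Proof. by move=> y x z; rewrite /r; lia. Qed.

Lemma cols_cycle_rows (s : seq (square n)) : cols (cycle_rows s) = cols s.
Proof. by apply: unzip1_zip; rewrite size_rot !size_map. Qed.

Lemma rows_cycle_rows (s : seq (square n)) :
  rows (cycle_rows s) = rot 1 (rows s).
Proof. by apply: unzip2_zip; rewrite size_rot !size_map. Qed.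

Lemma uniq_cols (s : seq (square n)) : sorted r s -> uniq (cols s).
Proof.
move=> ss; have: pairwise r s by rewrite -sorted_pairwise.
rewrite uniq_pairwise /cols pairwise_map; apply: sub_pairwise => x y.
by rewrite /r /= -val_eqE /=; lia.
Qed.

Lemma uniq_rows (s : seq (square n)) : sorted r s -> uniq (rows s).
Proof.
move=> ss; have: pairwise r s by rewrite -sorted_pairwise.
rewrite uniq_pairwise /rows pairwise_map; apply: sub_pairwise => x y.
by rewrite /r /= -val_eqE /=; lia.
Qed.


Lemma uniq_map_inj (T T' : eqType) (f : T -> T') (s : seq T) :
  uniq (map f s) -> {in s &, injective f}.
Proof.
elim: s => //= a s IH /andP[fa us] x y; rewrite !inE.
case/predU1P=> [->|xs]; case/predU1P=> [->|ys] //.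
- by move=> e; rewrite e map_f in fa.
- by move=> e; rewrite -e map_f in fa.
- exact: IH.
Qed.

Lemma is_placement_phi_set F P :
  is_placement F P -> is_placement F (phi_set k F P).
Proof.
move=> plP; rewrite /phi_set; case: pickP => // s /andP[occ _].
case/and3P: occ => /allP sP ss /existsP[a /existsP[b /andP[abF /allP sab]]].
have [PF h1 h2] := is_placementP _ _ plP.
have zc : forall x, x \in cycle_rows s -> exists2 y, y \in tval s & x.1 = y.1.
  by move=> x /(map_f (fun x => x.1)); rewrite -/(cols _) cols_cycle_rows => /mapP.
have zr : forall x, x \in cycle_rows s -> exists2 y, y \in tval s & x.2 = y.2.
  move=> x /(map_f (fun x => x.2)); rewrite -/(rows _) rows_cycle_rows mem_rot.
  by move=> /mapP.
have uc : uniq (cols (cycle_rows s)) by rewrite cols_cycle_rows uniq_cols.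
have ur : uniq (rows (cycle_rows s)).
  by rewrite rows_cycle_rows rot_uniq uniq_rows.
apply/is_placementP; split.
- apply/subsetP=> x; rewrite !inE => /orP[/andP[_ /(subsetP PF)] //|xz].
  apply: (subsetP abF); have [y ys e1] := zc _ xz; have [z zs e2] := zr _ xz.
  by move: (sab _ ys) (sab _ zs); rewrite !inE e1 e2 => /andP[-> _] /andP[_ ->].
- move=> x y; rewrite !inE => /orP[/andP[xs xP]|xz] /orP[/andP[ys yP]|yz] e.
  + exact: h1.
  + have [w ws ew] := zc _ yz; move: xs.
    by rewrite (h1 x w xP (sP _ ws)) ?ws // e.
  + have [w ws ew] := zc _ xz; move: ys.
    by rewrite (h1 y w yP (sP _ ws)) ?ws // -e.
  + exact: (uniq_map_inj uc) e.
- move=> x y; rewrite !inE => /orP[/andP[xs xP]|xz] /orP[/andP[ys yP]|yz] e.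
  + exact: h2.
  + have [w ws ew] := zr _ yz; move: xs.
    by rewrite (h2 x w xP (sP _ ws)) ?ws // e.
  + have [w ws ew] := zr _ xz; move: ys.
    by rewrite (h2 y w yP (sP _ ws)) ?ws // -e.
  + exact: (uniq_map_inj ur) e.
Qed.

Definition phi F (P : placement F) : placement F :=
  Placement (is_placement_phi_set (placementP P)).

Lemma smallest_occurrence_exists F P :
  has_occurrence k F P -> exists s, smallest_occurrence (k := k) F P s.
Proof.
move=> /existsP[s0 occ0].
pose s := [arg min_(s < s0 | occurrence F P s) row_word s]%O.
exists s; rewrite /s; case: Order.TotalTheory.arg_minP => // t occt tmin.
apply/andP; split=> //.
by apply/forallP => u; apply/implyP; apply: tmin.
Qed.

(* Iterating phi terminates because the sum of i * j over the squares (i, j) of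
   the placement increases strictly at each step. *)
Let wt (x : square n) : nat := x.1 * x.2.

Let weight P := \sum_(x in P) wt x.

Let wt_path (x : square n) (s : seq (square n)) (c : 'I_n) :
  path r x s -> x.2 <= c ->
  \sum_(y <- x :: s) wt y + x.1 * (c - x.2)
    <= \sum_(y <- zip (x.1 :: cols s) (rcons (rows s) c)) wt y.
Proof.
elim: s x => [|y s IH] x /=.
  by move=> _ xc; rewrite !big_seq1 /wt /= -mulnDr subnKC.
move=> /andP[/andP[xy1 xy2] ys] xc; rewrite big_cons [leqRHS]big_cons.
have yc : y.2 <= c by lia.
have := IH y ys yc; move: (\sum_(_ <- y :: s) _) (\sum_(_ <- zip _ _) _).
rewrite /wt /= => A B hAB.
have : x.1 * (c - y.2) <= y.1 * (c - y.2) by apply: leq_mul => //; lia.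
have -> : x.1 * x.2 + A + x.1 * (c - x.2) = x.1 * c + A.
  by rewrite addnAC -mulnDr subnKC.
have -> : x.1 * c = x.1 * y.2 + x.1 * (c - y.2) :> nat.
  by rewrite -mulnDr subnKC.
by lia.
Qed.

Let wt_cycle_rows (s : seq (square n)) :
  1 < size s -> sorted r s ->
  \sum_(y <- s) wt y < \sum_(y <- cycle_rows s) wt y.
Proof.
case: s => [|x [|y s]] //= _ /andP[/andP[xy1 xy2] ys].
rewrite /cycle_rows /rows map_cons rot1_cons /= big_cons [ltnRHS]big_cons.
have := @wt_path y s x.2 ys (ltnW xy2).
move: (\sum_(_ <- y :: s) _) (\sum_(_ <- zip _ _) _).
rewrite /wt /= => A B hAB.
have : x.1 * (x.2 - y.2) < y.1 * (x.2 - y.2) by rewrite ltn_pmul2r // subn_gt0.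
have -> : x.1 * x.2 = x.1 * y.2 + x.1 * (x.2 - y.2) :> nat.
  by rewrite -mulnDr subnKC // ltnW.
by lia.
Qed.

Let weight_phi_set F P : 1 < k -> is_placement F P -> has_occurrence k F P ->
  weight P < weight (phi_set k F P).
Proof.
move=> hk plP occP; rewrite /phi_set; case: pickP => [s|none]; last first.
  by have [s] := smallest_occurrence_exists occP; rewrite none.
case/andP=> /and3P[/allP sP ss _] _.
have [PF h1 _] := is_placementP _ _ plP.
rewrite /weight (big_setID [set x in tval s]) /=.
have -> : P :&: [set x in tval s] = [set x in tval s].
  by apply/setIidPr/subsetP => x; rewrite inE; apply: sP.
have dis : [disjoint P :\: [set x in tval s] & [set x in cycle_rows s]].
  rewrite disjoint_subset; apply/subsetP=> x; rewrite !inE => /andP[xs xP].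
  apply/negP=> /(map_f (fun x => x.1)).
  rewrite -/(cols _) cols_cycle_rows => /mapP[w ws e].
  by move: xs; rewrite (h1 x w xP (sP _ ws) e) ws.
rewrite (eq_bigl _ _ (fun x => in_setU x _ _)) bigU //=.
have us : uniq (tval s) by apply: map_uniq (uniq_cols ss).
have uz : uniq (cycle_rows s).
  have: uniq (cols (cycle_rows s)) by rewrite cols_cycle_rows uniq_cols.
  exact: map_uniq.
have E (z : seq (square n)) : uniq z ->
    \sum_(x in [set x in z]) wt x = \sum_(x <- z) wt x.
  by move=> uzz; rewrite [RHS]big_uniq //; apply: eq_bigl => x; rewrite inE.
rewrite !E // addnC ltn_add2l; apply: wt_cycle_rows => //.
by rewrite size_tuple.
Qed.

Lemma phi_terminates F (P : placement F) : 1 < k ->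
  exists m, ~~ has_occurrence k F (iter m (@phi F) P).
Proof.
move=> hk; pose B := weight setT.
have wB (Q : placement F) : weight Q <= B.
  by rewrite /B /weight [leqRHS](big_setID (squares Q)) /= setTI leq_addr.
have [m] := ubnP (B - weight P); elim: m P => // m IH P hm.
have [occ|nocc] := boolP (has_occurrence k F P); last by exists 0.
have lt1 := weight_phi_set hk (placementP P) occ.
have [|m' hm'] := IH (phi P).
  by have := wB (phi P); rewrite /= in lt1 *; lia.
by exists m'.+1; rewrite iterSr.
Qed.

Definition phi_star F (hk : 1 < k) (P : placement F) : placement F :=
  iter (ex_minn (phi_terminates P hk)) (@phi F) P.

End PhiPlacement.

(* Main.v *)
Require Import Defs.
From mathcomp Require Import all_boot all_order.
From mathcomp Require Import zify.

(* The invariant is a modified growth diagram (after Bloom and Saracino).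
   Every rook sends a line upwards and a line to the right, both of colour 1;
   where two lines of the same colour c meet, both continue with colour c + 1,
   except that colour k - 1 is followed by colour 1.  The rule is symmetric
   under transposition.  In a placement without k ... 1 the exception never
   occurs inside the board, so the rule can be run backwards and the placement
   is recovered from the colours on the border of the board.  Hence it is
   enough that phi preserves these colours.

   Below the top row of the smallest occurrence x_1, ..., x_k the colours can be
   read off level by level: the lines of colour 1 die where they meet, these
   crossings are the rooks of the next level, and so on.  Let (a_r, b_r) be the
   lowest leftmost crossing between x_r and x_{r+1}.  Cycling the rows of the
   x_r amounts to flipping, in every box [x_r.1, a_r] x [x_{r+1}.2, b_r], the
   live right and upper side to the left and lower side; on the crossings it
   again acts as the cycling of a chain, namely (a_1, b_1), ...,
   (a_{k-1}, b_{k-1}), which starts in the same row and ends in the same column.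
   After k - 1 levels a single point is left, which is where the rook that has
   moved to the end of the top row imitates the exceptional crossing. *)

Set Implicit Arguments.
Unset Strict Implicit.
Unset Printing Implicit Defensive.

(** * Growth diagrams and live lines *)

Notation point := (nat * nat)%type.

Section Growth.

Variables (T : Type) (c0 : T) (f : bool -> T -> T -> T * T).
Implicit Types (A Z : pred point) (c r : nat -> nat -> T).

(** A row is evaluated from left to right once the labels on its lower sides are known; [f] returns
    the label above first, the label to the right second. *)
Fixpoint sweep (a : pred nat) (c : nat -> T) i : T :=
  if i is i'.+1 then (f (a i') (c i') (sweep a c i')).2 else c0.

Fixpoint ups A j : nat -> T :=
  if j is j'.+1 then
    fun i => (f (A (i, j')) (ups A j' i)
                (sweep (fun i => A (i, j')) (ups A j') i)).1
  else fun=> c0.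

Definition up A i j := ups A j i.
Definition across A i j := sweep (fun i => A (i, j)) (ups A j) i.

(* [c i j] sits on the lower side of the square [(i, j)] and [r i j] on its
   left side. *)
Definition growth A c r :=
  [/\ forall i, c i 0 = c0, forall j, r 0 j = c0 &
      forall i j, (c i j.+1, r i.+1 j) = f (A (i, j)) (c i j) (r i j)].

Lemma growthP A : growth A (up A) (across A).
Proof. by split=> // i j; rewrite /up /across /=; case: (f _ _ _). Qed.

(** Induction on [i + j]: the lower and left labels of a square determine the other two. The closure
    conditions keep the walk back to column [i0] or row [j0] inside [Z]. *)
Lemma growth_propagate Z i0 j0 A A' c r c' r' :
    growth A c r -> growth A' c' r' ->
    (forall i j, i0 <= i -> Z (i.+1, j) -> Z (i, j)) ->
    (forall i j, j0 <= j -> Z (i, j.+1) -> Z (i, j)) ->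
    (forall i j, i0 <= i -> j0 <= j -> Z (i, j) -> A (i, j) = A' (i, j)) ->
    (forall i, i0 <= i -> Z (i, j0) -> c i j0 = c' i j0) ->
    (forall j, j0 <= j -> Z (i0, j) -> r i0 j = r' i0 j) ->
  forall i j, i0 <= i -> j0 <= j -> Z (i, j) ->
    [/\ c i j = c' i j, r i j = r' i j,
        c i j.+1 = c' i j.+1 & r i.+1 j = r' i.+1 j].
Proof.
move=> [_ _ G] [_ _ G'] Zl Zd AA' c_eq r_eq i j.
have [m] := ubnP (i + j); elim: m i j => // m IH i j lt_m i0i j0j Zij.
have ein : c i j = c' i j /\ r i j = r' i j.
  split.
    move: j0j; rewrite leq_eqVlt => /predU1P[e|lt0].
      by rewrite -e c_eq // e.
    case: j lt0 Zij lt_m => // j lt0 Zij lt_m.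
    by case: (IH i j _ i0i lt0 (Zd _ _ lt0 Zij)) => //; lia.
  move: i0i; rewrite leq_eqVlt => /predU1P[e|lt0].
    by rewrite -e r_eq // e.
  case: i lt0 Zij lt_m => // i lt0 Zij lt_m.
  by case: (IH i j _ lt0 j0j (Zl _ _ lt0 Zij)) => //; lia.
case: ein => ec er; split=> //.
  by have := G i j; rewrite ec er AA' // -G' => -[].
by have := G i j; rewrite ec er AA' // -G' => -[].
Qed.

Lemma growth_unique A A' c r c' r' : growth A c r -> growth A' c' r' ->
  A =1 A' -> (c =2 c') /\ (r =2 r').
Proof.
move=> G G' e.
have H i j : [/\ c i j = c' i j, r i j = r' i j,
        c i j.+1 = c' i j.+1 & r i.+1 j = r' i.+1 j].
  apply: (@growth_propagate xpredT 0 0 A A') => //; case: G G' => [g1 g2 _] [g1' g2' _].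
  - by move=> ? _ _; rewrite g1 g1'.
  - by move=> ? _ _; rewrite g2 g2'.
by split=> i j; case: (H i j).
Qed.

Hypothesis f_sym : forall a x y, f a y x = ((f a x y).2, (f a x y).1).

Lemma growth_swap A c r : growth A c r ->
  growth (fun q => A (q.2, q.1)) (fun i j => r j i) (fun i j => c j i).
Proof.
by move=> [c1 r1 G]; split=> // i j; rewrite /= f_sym -G.
Qed.

End Growth.

(** With this rule the live sides trace Viennot's shadow lines; [peel] is then their skeleton. *)
Definition live_cell (a x y : bool) : bool * bool :=
  if a then (true, true) else if x && y then (false, false) else (x, y).

Definition live := growth false live_cell.
Definition lup := up false live_cell.
Definition lacross := across false live_cell.
Arguments lup : simpl never.
Arguments lacross : simpl never.
Arguments up : simpl never.
Arguments across : simpl never.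

Definition peel (A : pred point) : pred point :=
  fun q => lup A q.1 q.2 && lacross A q.1 q.2.

Definition placed (A : pred point) :=
  (forall i j j', A (i, j) -> A (i, j') -> j = j') /\
  (forall i i' j, A (i, j) -> A (i', j) -> i = i').

Lemma liveP A : live A (lup A) (lacross A).
Proof. exact: growthP. Qed.

Lemma live_cell_sym a x y :
  live_cell a y x = ((live_cell a x y).2, (live_cell a x y).1).
Proof. by case: a x y => [] [] []. Qed.

Notation swap A := (fun q : point => A (q.2, q.1)).

Lemma lup_swap A i j : lup (swap A) i j = lacross A j i.
Proof.
have [e _] := growth_unique (growth_swap live_cell_sym (liveP A))
  (liveP (swap A)) (fun _ => erefl).
by rewrite -e.
Qed.

Lemma lacross_swap A i j : lacross (swap A) i j = lup A j i.
Proof.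
have [_ e] := growth_unique (growth_swap live_cell_sym (liveP A))
  (liveP (swap A)) (fun _ => erefl).
by rewrite -e.
Qed.

Lemma placed_swap A : placed A -> placed (swap A).
Proof. by case=> h1 h2; split=> /= i j k; [apply: h2|apply: h1]. Qed.

Lemma peel_swap A q : peel (swap A) q = peel A (q.2, q.1).
Proof. by rewrite /peel lup_swap lacross_swap andbC. Qed.

Section Live.

Variable A : pred point.
Hypothesis plA : placed A.

Lemma lupS i j : lup A i j.+1 = (live_cell (A (i, j)) (lup A i j) (lacross A i j)).1.
Proof. by case: (liveP A) => _ _ <-. Qed.

Lemma lacrossS i j :
  lacross A i.+1 j = (live_cell (A (i, j)) (lup A i j) (lacross A i j)).2.
Proof. by case: (liveP A) => _ _ <-. Qed.

Lemma lup_source i j : lup A i j ->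
  exists d, [/\ d < j, A (i, d) & forall y, d < y <= j -> lup A i y].
Proof.
elim: j => [|j IH]; first by [].
move=> Lj; have := Lj; rewrite lupS /live_cell; case: ifP => [aij _|_].
  exists j; split=> // y /andP[jy yj]; suff -> : y = j.+1 by [].
  by apply/eqP; rewrite eqn_leq yj jy.
case: ifP => // _ /= /IH [d [dj aid h]]; exists d; split=> //; first by lia.
by move=> y; have [-> //|ne dy] := eqVneq y j.+1; apply: h; lia.
Qed.

Lemma lup_above i j y : A (i, j) -> y <= j -> lup A i y = false.
Proof.
move=> aij yj; apply/negP => /lup_source[d [dy aid _]].
by have := plA.1 _ _ _ aij aid; lia.
Qed.

End Live.

Lemma lacross_source A i j : lacross A i j ->
  exists d, [/\ d < i, A (d, j) & forall y, d < y <= i -> lacross A y j].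
Proof.
rewrite -lup_swap => /lup_source [d [di aid h]]; exists d; split=> // y.
by move/h; rewrite lup_swap.
Qed.

Lemma lacross_left A i j y : placed A ->
  A (i, j) -> y <= i -> lacross A y j = false.
Proof.
move=> /placed_swap plA aij yi; rewrite -lup_swap.
exact: (lup_above plA (i := j) (j := i)).
Qed.

Lemma cross_dies A i j : placed A -> lup A i j -> lacross A i j ->
  lup A i j.+1 = false /\ lacross A i.+1 j = false.
Proof.
move=> plA u a; rewrite lupS lacrossS u a /=.
case aij: (A (i, j)) => //; by have := lup_above plA aij (leqnn _); rewrite u.
Qed.

(** A column has one rook, hence one vertical line, and that line dies at its first crossing. Rows
    follow by transposition. *)
Lemma peel_placed A : placed A -> placed (peel A).
Proof.
have H B i j j' : placed B -> j < j' -> peel B (i, j) -> peel B (i, j') -> False.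
  move=> plB jj' /andP[/= u a] /andP[/= u' _].
  have [d [dj ad hd]] := lup_source u; have [d' [dj' ad' hd']] := lup_source u'.
  have dd := plB.1 _ _ _ ad ad'; have [z _] := cross_dies plB u a.
  by have := hd' j.+1; rewrite z; apply/implyP; lia.
move=> plA; split=> [i j j'|i i' j] p p'.
  by case: (ltngtP j j') => // lt; [case: (H A i j j')|case: (H A i j' j)].
have plS := placed_swap plA.
by case: (ltngtP i i') => // lt; [case: (H (swap A) j i i')|case: (H (swap A) j i' i)];
   rewrite // peel_swap.
Qed.

Lemma iter_peel_placed A m : placed A -> placed (iter m peel A).
Proof. by move=> plA; elim: m => //= m; apply: peel_placed. Qed.

Lemma peel_ext A A' : A =1 A' -> peel A =1 peel A'.
Proof.
move=> e q; have [e1 e2] := growth_unique (liveP A) (liveP A') e.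
by rewrite /peel e1 e2.
Qed.

Ltac nlia :=
  repeat match goal with
    | H : context [all] |- _ => clear H
    | H : context [path] |- _ => clear H
    | H : context [lup] |- _ => clear H
    | H : context [lacross] |- _ => clear H
    | H : context [size] |- _ => clear H
    | H : is_true (_ (_, _)) |- _ => clear H
    end; lia.

(** The second argument is the lower one, so [path below] lists a decreasing chain from left to
    right. *)
Definition below (x y : point) := (x.1 < y.1) && (y.2 < x.2).

Lemma below_trans : transitive below.
Proof. by move=> y x z; rewrite /below; lia. Qed.

(* A point [p] of [peel A] has a point of [A] to its left, [(l, p.2)], and one
   underneath, [(p.1, d)]; for a chain one of the two can always be chosen. *)
Lemma peel_lift A p t : placed A -> path below p t -> all (peel A) (p :: t) ->
  exists c : seq point, [/\ size c = size (p :: t), all A c, sorted below c &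
    all (fun z => [&& p.1 <= z.1, z.2 < p.2 & z.1 <= (last p t).1]) c].
Proof.
move=> plA; elim: t p => [|p2 t IH] p /=.
  move=> _; rewrite andbT => /andP[/lup_source[d [dp ad _]] _].
  by exists [:: (p.1, d)]; rewrite /= ad dp !leqnn.
move=> /andP[/andP[lt1 lt2] pt] /and3P[Bp Bp2 Bt].
have [|c [sc Ac pc bc]] := IH p2 pt; first by rewrite /= Bp2.
have lastc : p2.1 <= (last p2 t).1.
  elim: t p2 pt {IH lt1 lt2 Bp2 sc bc Bt} => //= a t IH p2 /andP[/andP[h _] /IH].
  by nlia.
have bc' z : z.1 <= p2.1 -> p2.2 <= z.2 -> A z ->
    z.1 < p2.1 \/ p2.2 < z.2 -> p.1 <= z.1 -> z.2 < p.2 ->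
    all (below z) c ->
    exists c : seq point, [/\ size c = (size t).+2, all A c, sorted below c &
    all (fun z => [&& p.1 <= z.1, z.2 < p.2 & z.1 <= (last p2 t).1]) c].
  move=> z1 z2 az _ pz zp zc; exists (z :: c); split.
  - by rewrite /= sc.
  - by rewrite /= az.
  - by rewrite (sorted_pairwise below_trans) /= zc -(sorted_pairwise below_trans).
  rewrite /= pz zp (leq_trans z1 lastc) /=.
  by apply: sub_all bc => q; nlia.
case/andP: Bp => u1 _; case/andP: Bp2 => _ a2.
have [d [dp ad hd]] := lup_source u1; have [l [lp al hl]] := lacross_source a2.
(* If [l] is too far left, its line passes column [p.1] in row [p2.2]. A rook [(p.1, d)] under that
   row would send up a line that dies there before reaching [p]; so [(p.1, d)] lies above that row
   and can be chosen. *)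
have [pl|lp1] := leqP p.1 l.
  apply: (bc' (l, p2.2)) => //=; try nlia.
  by apply: sub_all bc => q; rewrite /below /=; nlia.
have [dp2|p2d|e] := ltngtP d p2.2.
- have [z _] : lup A p.1 p2.2.+1 = false /\ lacross A p.1.+1 p2.2 = false.
    by apply: cross_dies => //; [apply: hd|apply: hl]; nlia.
  by have := hd p2.2.+1; rewrite z => e; have: false by apply: e; nlia.
- apply: (bc' (p.1, d)) => //=; try nlia.
  by apply: sub_all bc => q; rewrite /below /=; nlia.
- move: ad; rewrite e => ad.
  by have := plA.2 _ _ _ ad al; nlia.
Qed.

(** * Flipping a box *)

(** [h] describes lower sides and [v] left sides. Partway through a series of flips a column may
    hold two rooks, so [placed] is too strong; what survives is that no line enters a rook. *)
Definition config (A : pred point) h v :=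
  live A h v /\ forall i j, A (i, j) -> h i j = false /\ v i j = false.

Section Flip.

Variables (A : pred point) (h v : nat -> nat -> bool) (a b c d : nat).

Definition empty_box :=
  [/\ a < b /\ c < d,
      forall i j, a <= i < b -> c <= j <= d -> (i == a) || (c < j) ->
        h i j = false,
      forall j, c < j <= d -> h b j,
      forall i j, a <= i <= b -> c <= j < d -> (j == c) || (a < i) ->
        v i j = false &
      forall i, a < i <= b -> v i d].

Definition flip_up i j :=
  if c < j <= d then if i == a then true else if i == b then false else h i j
  else h i j.

Definition flip_across i j :=
  if a < i <= b then if j == c then true else if j == d then false else v i j
  else v i j.

Definition flip : pred point :=
  fun q => (q == (a, c)) || [&& A q, q != (a, d) & q != (b, c)].

Let side_cases m n i : m < n ->
  ((m < i, m <= i), (i < n, i <= n), (i == m, i == n)) \in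
    [:: ((false, false), (true, true), (false, false));
        ((false, true), (true, true), (true, false));
        ((true, true), (true, true), (false, false));
        ((true, true), (false, true), (false, true));
        ((true, true), (false, false), (false, false))].
Proof.
move=> mn; case: (ltngtP i m) => im; case: (ltngtP i n) => ni;
  rewrite ?inE //; lia.
Qed.

Let flip_config_at i j : config A h v -> empty_box ->
  [/\ (flip_up i j.+1, flip_across i.+1 j) =
        live_cell (flip (i, j)) (flip_up i j) (flip_across i j),
     flip (i, j) -> flip_up i j = false /\ flip_across i j = false &
     flip_up i j && flip_across i j =
      [|| [&& h i j, v i j & (i, j) != (b, d)],
          ((i, j) == (a, d)) && ~~ A (i, j) |
          ((i, j) == (b, c)) && ~~ A (i, j)]].
Proof.
move=> [[h0 v0 G] dead] [[ab cd] H1 H2 V1 V2].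
have := G i j; have := dead i j.
have H1' : a <= i < b -> c <= j < d -> h i j.+1 = false.
  by move=> ? ?; apply: H1; lia.
have V1' : a <= i < b -> c <= j < d -> v i.+1 j = false.
  by move=> ? ?; apply: V1; lia.
have H2' : i == b -> (c < j <= d -> h i j) /\ (c < j.+1 <= d -> h i j.+1).
  by move=> /eqP->; split; apply: H2.
have V2' : j == d -> (a < i <= b -> v i j) /\ (a < i.+1 <= b -> v i.+1 j).
  by move=> /eqP->; split; apply: V2.
have := H1 i j; have := V1 i j; move: H1' V1' H2' V2'.
rewrite /flip_up /flip_across /flip /live_cell !xpair_eqE !ltnS.
(* Each coordinate has five positions relative to its two bounds; each of the 25 combinations is a
   truth table in five booleans. *)
have := side_cases i ab; have := side_cases j cd; clear.
move: (h i j) (h i j.+1) (v i j) (v i.+1 j) (A (i, j)).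
move: (a < i) (a <= i) (i < b) (i <= b) (i == a) (i == b).
move: (c < j) (c <= j) (j < d) (j <= d) (j == c) (j == d).
move=> c1 c2 c3 c4 c5 c6 a1 a2 a3 a4 a5 a6 h1 h2 v1 v2 a0.
rewrite !inE.
repeat (case/orP); move/eqP=> [-> -> -> -> -> ->];
  repeat (case/orP); move/eqP=> [-> -> -> -> -> ->];
  case: h1; case: h2; case: v1; case: v2; case: a0 => //=; move=> *;
  repeat match goal with
    | H : _ /\ _ |- _ => destruct H
    | H : is_true true -> _ |- _ => specialize (H isT)
    | H : is_true false -> _ |- _ => clear H
    end; by [].
Qed.

(** The crossing [(b, d)] disappears. At [(a, d)] the new vertical line from [(a, c)] either
    replaces the line sent upwards by the removed rook, or meets and stops the horizontal line that
    used to enter there, which gives a new crossing. The square [(b, c)] is symmetric. *)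
Lemma flip_config : config A h v -> empty_box ->
  config flip flip_up flip_across /\
  forall q, flip_up q.1 q.2 && flip_across q.1 q.2 =
    [|| [&& h q.1 q.2, v q.1 q.2 & q != (b, d)],
        (q == (a, d)) && ~~ A q | (q == (b, c)) && ~~ A q].
Proof.
move=> cf bx; split; last by case=> i j; case: (flip_config_at i j cf bx).
split; last by move=> i j; case: (flip_config_at i j cf bx).
split=> [i|j|i j]; last by case: (flip_config_at i j cf bx).
  by rewrite /flip_up ltn0; case: cf => -[-> _ _] _.
by rewrite /flip_across ltn0; case: cf => -[_ -> _] _.
Qed.

End Flip.

(** * Corners of a tight chain *)

(** The default is [b], returned when [p] fails on all of [[a, b)]. *)
Definition least (p : pred nat) a b := a + find p (iota a (b - a)).

Lemma leastP p a b (u := least p a b) : a <= b ->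
  [/\ a <= u <= b, u < b -> p u & forall w, a <= w < u -> p w = false].
Proof.
move=> ab; rewrite /u /least; set t := iota _ _.
have le : find p t <= b - a by rewrite -[b - a in leqRHS](size_iota a) find_size.
split=> [|lt|w /andP[aw wu]]; first by lia.
- have ltf : find p t < b - a by lia.
  have := @nth_find _ 0 p t; rewrite has_find size_iota => /(_ ltf).
  by rewrite nth_iota.
- have := @before_find _ 0 p t (w - a); rewrite nth_iota ?subnKC //; last by lia.
  by apply; lia.
Qed.

(** The two coordinates are searched separately. The defaults [y.1] and [x.2] carry lines as well,
    since [y] sends one upwards and [x] one to the right. *)
Definition corner A (x y : point) : point :=
  (least (fun u => lup A u y.2.+1) x.1.+1 y.1,
   least (lacross A x.1.+1) y.2.+1 x.2).
Arguments corner : simpl never.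

Section Corner.

Variables (A : pred point) (x y : point).
Hypotheses (plA : placed A) (Ax : A x) (Ay : A y) (xy : below x y).
Let q := corner A x y.

Lemma corner_bounds : (x.1 < q.1 <= y.1) && (y.2 < q.2 <= x.2).
Proof.
case/andP: xy => xy1 xy2.
have [h1 _ _] := leastP (fun u => lup A u y.2.+1) xy1.
have [h2 _ _] := leastP (lacross A x.1.+1) xy2.
by apply/andP; split; [exact: h1|exact: h2].
Qed.

Lemma corner_lup : lup A q.1 y.2.+1.
Proof.
case/andP: xy => xy1 xy2.
have [/andP[_ le] h _] := leastP (fun u => lup A u y.2.+1) xy1.
move: le; rewrite leq_eqVlt => /predU1P[e|/h //]; rewrite /q /corner /= e.
by rewrite lupS -surjective_pairing Ay.
Qed.

Lemma corner_lacross : lacross A x.1.+1 q.2.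
Proof.
case/andP: xy => xy1 xy2.
have [/andP[_ le] h _] := leastP (lacross A x.1.+1) xy2.
move: le; rewrite leq_eqVlt => /predU1P[e|/h //].
by rewrite /q /corner /= e lacrossS -surjective_pairing Ax.
Qed.

Lemma corner_lup_least u : x.1 < u < q.1 -> lup A u y.2.+1 = false.
Proof.
case/andP: xy => xy1 xy2.
by have [_ _] := leastP (fun u => lup A u y.2.+1) xy1; apply.
Qed.

Lemma corner_lacross_least w : y.2 < w < q.2 -> lacross A x.1.+1 w = false.
Proof.
case/andP: xy => xy1 xy2.
by have [_ _] := leastP (lacross A x.1.+1) xy2; apply.
Qed.

Hypothesis between :
  forall z, A z -> x.1 < z.1 < y.1 -> y.2 < z.2 < x.2 -> False.

(** Induction on the rows: the box has no rook strictly between [x] and [y], and no line enters from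
    the left below row [q.2], so the line in column [q.1] stays the only vertical one up to row
    [q.2]. *)
Lemma corner_box : empty_box (lup A) (lacross A) x.1 q.1 y.2 q.2.
Proof.
move: corner_bounds corner_lup corner_lacross corner_lup_least
  corner_lacross_least; case: q => b d /=.
move=> /andP[/andP[xq1 qy1] /andP[yq2 qx2]] hup hac hup0 hac0.
have Ax' : A (x.1, x.2) by rewrite -surjective_pairing.
have Ay' : A (y.1, y.2) by rewrite -surjective_pairing.
have noA i j : x.1 < i < b -> y.2 < j <= d -> A (i, j) = false.
  move=> hi hj; apply/negP => aij.
  have [jx|jx] := eqVneq j x.2.
    by have := plA.2 i x.1 j; rewrite {2}jx => /(_ aij Ax'); nlia.
  by apply: (between aij) => /=; nlia.
have noA' j : y.2 < j < d -> A (b, j) = false.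
  move=> hj; apply/negP => aij.
  have [jx|jx] := eqVneq b y.1.
    by have := plA.1 b j y.2; rewrite {2}jx => /(_ aij Ay'); nlia.
  by apply: (between aij) => /=; nlia.
pose U j := (forall i, x.1 < i < b -> lup A i j = false) /\ lup A b j.
have UR j : y.2 < j < d -> U j -> forall i, x.1 < i <= b -> lacross A i j = false.
  move=> hj [Uj _]; elim=> // i IH hi.
  have [<-|ne] := eqVneq x.1 i; first exact: hac0.
  by rewrite lacrossS noA ?Uj ?IH //; nlia.
have Uall j : y.2 < j <= d -> U j.
  elim: j => // j IH hj.
  have [e|ne] := eqVneq y.2 j.
    by rewrite -e; split; [exact: hup0|exact: hup].
  have Uj : U j by apply: IH; nlia.
  have Rj := UR j _ Uj; split=> [i hi|].
    by rewrite lupS noA ?(Uj.1) ?Rj //; nlia.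
  by rewrite lupS noA' ?Rj ?(Uj.2) //; nlia.
split=> [|i j hi hj|j hj|i j hi hj|i].
- by split.
- case/orP=> [/eqP->|cj]; first by apply: (lup_above plA Ax'); nlia.
  have [->|ne] := eqVneq i x.1; first by apply: (lup_above plA Ax'); nlia.
  by apply: (Uall j _).1; nlia.
- exact: (Uall j hj).2.
- case/orP=> [/eqP->|ai]; first by apply: (lacross_left plA Ay'); nlia.
  have [->|ne] := eqVneq j y.2; first by apply: (lacross_left plA Ay'); nlia.
  by apply: UR; rewrite ?ai; try nlia; apply: Uall; nlia.
- elim: i => // i IH hi.
  have [<-|ne] := eqVneq x.1 i; first exact: hac.
  rewrite lacrossS noA ?(Uall d _).1 ?IH //; nlia.
Qed.

End Corner.

(* The smallest occurrence is tight, and the corners of a tight chain form a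
   tight chain of crossings. *)
Fixpoint tight (A : pred point) m p (s : seq point) : Prop :=
  if s is x :: s' then
    (forall t, size t = size s -> all A t -> sorted below t ->
       all (fun z => (p <= z.1 <= m) && (z.2 < x.2)) t -> False) /\
    tight A m x.1.+1 s'
  else True.

Definition corners A (s : seq point) :=
  if s is x :: s' then pairmap (corner A) x s' else [::].

Lemma tight_between A m p x y s z :
  all A (y :: s) -> path below x (y :: s) -> (last y s).1 = m ->
  tight A m p [:: x, y & s] ->
  A z -> p <= z.1 < y.1 -> y.2 < z.2 < x.2 -> False.
Proof.
move=> As /= /andP[/andP[xy1 xy2] ys] em [T _] Az z1 z2.
have bound : all (fun w => (w.1 <= m) && (w.2 <= y.2) && (y.1 <= w.1)) (y :: s).
  elim: s y {As T Az z1 z2 xy1 xy2} ys em => /= [y _ ->|w s IH y /andP[/andP[yw1 yw2] ws] em].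
    by rewrite !leqnn.
  have /= /andP[h1 h2] := IH w ws em.
  rewrite !leqnn !andbT; apply/and3P; split; [lia|lia|].
  by apply: sub_all h2 => v; lia.
apply: (T [:: z, y & s]) => //=; first by rewrite Az.
  by rewrite ys /below; lia.
case/andP: bound => b1 b2; apply/and3P; split; [lia|lia|].
by apply: sub_all b2 => v; lia.
Qed.

Lemma size_corners A x s : size (corners A (x :: s)) = size s.
Proof. exact: size_pairmap. Qed.

Lemma cornersE A x y s :
  corners A [:: x, y & s] = corner A x y :: corners A (y :: s).
Proof. by []. Qed.

Lemma below_last x s : path below x s -> x.1 <= (last x s).1.
Proof.
elim: s x => //= y s IH x /andP[/andP[xy _] /IH].
by apply: leq_trans; apply: ltnW.
Qed.

(** A lower chain of crossings lifts by [peel_lift], and the rook left of its first crossing adds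
    one more point. This contradicts tightness unless that rook lies left of column [p]. In the
    recursion [u] is the column of the previous corner, whose line serves to exclude the remaining
    case. *)
Lemma tight_peel A m s x p p' :
    placed A -> all A (x :: s) -> path below x s -> (last x s).1 = m ->
    tight A m p (x :: s) ->
    (p' = 0 /\ p = 0 \/
     exists u, [/\ p' = u.+1, p <= u <= x.1 & lup A u x.2.+1]) ->
  tight (peel A) m p' (corners A (x :: s)).
Proof.
move=> plA; elim: s x p p' => [|y s IH] x p p' // As pt em T hp.
have [Ax /andP[Ay _]] := andP As; have /andP[xy _] := pt.
have plx : forall i, A (i, x.2) -> i = x.1.
  by move=> i ai; apply: (plA.2 _ _ x.2); rewrite -?surjective_pairing.
have ply : forall i, A (i, y.2) -> i = y.1.
  by move=> i ai; apply: (plA.2 _ _ y.2); rewrite -?surjective_pairing.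
have /andP[/andP[xq1 qy1] /andP[yq2 qx2]] := corner_bounds A xy.
case: (T) => T1 T2.
rewrite cornersE; split; last first.
  apply: (IH y x.1.+1) => //; [by case/andP: As|by case/andP: pt|].
  right; exists (corner A x y).1; split=> //; first by rewrite xq1.
  exact: corner_lup.
have := corner_lacross_least xy (A := A); move: yq2 qx2.
case: (corner A x y) => q1 q2 /= yq2 qx2 q2_least.
move=> [|z t] //= [st] Bt zt bt; case/andP: (bt) => /andP[/andP[pz zm] zy] bt'.
have [c [sc Ac pc bc]] := peel_lift plA zt Bt.
have lastzt : (last z t).1 <= m.
  have : all (fun w => w.1 <= m) (z :: t) by rewrite /= zm; apply: sub_all bt' => w; nlia.
  by move/allP; apply; apply: mem_last.
case/andP: Bt => /andP[_ /lacross_source[l [lz al hl]]] _.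
have size_c : size c = (size s).+1
  by rewrite sc /= st -[pairmap _ _ _]/(corners A (y :: s)) size_corners.
have lc : all (below (l, z.2)) c.
  by apply: sub_all bc => w; rewrite /below /=; nlia.
have pc' w : all (below w) c -> sorted below (w :: c).
  by move=> h; rewrite (sorted_pairwise below_trans) /= h -(sorted_pairwise below_trans).
have zx : z.2 < x.2 by nlia.
have [pl|lp] := leqP p l.
  apply: (T1 ((l, z.2) :: c)) => /=; rewrite ?size_c ?al ?Ac ?zx //; first exact: pc'.
  apply/andP; split; first by nlia.
  apply: sub_all bc => w; nlia.
case: hp => [[_ p0]|[u [pu ux hu]]]; first by nlia.
have [d [dx ad hd]] := lup_source hu.
(* As [l < u < z.1], the line from [(l, z.2)] passes column [u]. If [z] is not right of [x], the
   rook [(u, d)] must lie above row [z.2], since its line is still live above row [x.2], and it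
   starts a forbidden chain. Otherwise a low [z] beats the tail, and a high [z] contradicts the
   choice of [q2]. *)
have [zx1|xz1] := leqP z.1 x.1.
  have [dz|zd|e] := ltngtP d z.2.
  - have [e _] : lup A u z.2.+1 = false /\ lacross A u.+1 z.2 = false.
      by apply: cross_dies => //; [apply: hd|apply: hl]; nlia.
    by have := hd z.2.+1; rewrite e => h; suff : false by []; apply: h; nlia.
  - have dx' : d < x.2.
      have [e|] := eqVneq d x.2; last by nlia.
      by move: ad; rewrite e => /plx; nlia.
    apply: (T1 ((u, d) :: c)) => /=; rewrite ?size_c ?ad ?Ac //.
      by apply: pc'; apply: sub_all bc => w; rewrite /below /=; nlia.
    apply/andP; split; first by nlia.
    apply: sub_all bc => w; nlia.
  - by move: ad; rewrite e => ad; have := plA.2 _ _ _ ad al; nlia.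
have [zy2|yz2|e] := ltngtP z.2 y.2.
- case: T2 => T2 _; apply: (T2 c) => //.
  by apply: sub_all bc => w; nlia.
- have := q2_least z.2; rewrite yz2 zy => /(_ isT).
  by rewrite hl //; nlia.
- by move: al; rewrite e => /ply; case/andP: xy; nlia.
Qed.

(** A lower live row would start at a rook excluded by [tight_between]. Hence the top row is the
    same on all levels. *)
Lemma corner_first A m x y s : placed A ->
  all A [:: x, y & s] -> path below x (y :: s) -> (last y s).1 = m ->
  tight A m 0 [:: x, y & s] -> (corner A x y).2 = x.2.
Proof.
move=> plA /andP[Ax As] pt em T; have /andP[xy _] := pt; have /andP[Ay _] := As.
have /andP[_ /andP[yq2 qx2]] := corner_bounds A xy.
have /lacross_source[l [lx al _]] := corner_lacross Ax xy.
move: yq2 qx2 al; case: (corner A x y) => q1 q2 /= yq2 qx2 al.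
apply/eqP; rewrite eqn_leq qx2 leqNgt /=; apply/negP => lt.
case/andP: xy => xy1 xy2.
by apply: (tight_between As pt em T al) => /=; nlia.
Qed.

(** An earlier live column would contain a rook right of [x] and lower than [y], a one-point chain
    beating [y]. Hence the last column is the same on all levels. *)
Lemma corner_last A m x y : placed A -> A x -> A y -> below x y ->
  y.1 = m -> tight A m x.1.+1 [:: y] -> (corner A x y).1 = y.1.
Proof.
move=> plA Ax Ay xy em [T _].
have /andP[/andP[xq1 qy1] _] := corner_bounds A xy.
have /lup_source[d [dy ad _]] := corner_lup Ay xy.
move: xq1 qy1 ad; case: (corner A x y) => q1 q2 /= xq1 qy1 ad.
apply/eqP; rewrite eqn_leq qy1 leqNgt /=; apply/negP => lt.
apply: (T [:: (q1, d)]) => //=; first by rewrite ad.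
have [e|ne] := eqVneq d y.2; last by nlia.
have := plA.2 q1 y.1 y.2; rewrite -{1}e -surjective_pairing.
by move=> /(_ ad Ay); nlia.
Qed.

(** Otherwise some column [u < y.1] is live just above row [y.2], and some row [v < y.2] just right
    of column [y.1]. Tightness puts the rook of that row at or left of [x.1] and the rook of that
    column below [v]; the lines meet at [(u, v)] and die too early. *)
Lemma corner_meet A m x y z s : placed A ->
  all A [:: x, y, z & s] -> path below x [:: y, z & s] -> (last z s).1 = m ->
  tight A m x.1.+1 [:: y, z & s] ->
  (corner A x y).1 = y.1 \/ (corner A y z).2 = y.2.
Proof.
move=> plA /and4P[Ax Ay Az As] /and3P[xy yz zs] em T.
have btw := @tight_between A m x.1.+1 y z s.
have /andP[/andP[xq1 qy1] _] := corner_bounds A xy.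
have /andP[_ /andP[zr2 ry2]] := corner_bounds A yz.
have /lup_source[d [dy ad hd]] := corner_lup Ay xy.
have /lacross_source[l [ly al hl]] := corner_lacross Ay yz.
move: xq1 qy1 zr2 ry2 ad hd al hl.
case: (corner A x y) => u u'; case: (corner A y z) => v' v /=.
move=> xu uy zv vy ad hd al hl.
have [->|ne] := eqVneq u y.1; [by left|right].
apply/eqP; rewrite eqn_leq vy leqNgt /=; apply/negP => lt.
have noA w : A w -> x.1 < w.1 < z.1 -> z.2 < w.2 < y.2 -> False.
  by apply: btw => //; rewrite /= ?Az ?As ?yz.
case/andP: xy => xy1 xy2; case/andP: yz => yz1 yz2.
have lx : l <= x.1.
  by rewrite leqNgt; apply/negP => xl; apply: (noA _ al) => /=; nlia.
have du : d < v.
  rewrite ltnNge; apply/negP => vd.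
  have [e|ney] := eqVneq d y.2.
    have := plA.2 u y.1 y.2; rewrite -{1}e -surjective_pairing.
    by move=> /(_ ad Ay); nlia.
  by apply: (noA _ ad) => /=; nlia.
have [e _] : lup A u v.+1 = false /\ lacross A u.+1 v = false.
  by apply: cross_dies => //; [apply: hd|apply: hl]; nlia.
by have := hd v.+1; rewrite e => h; suff : false by []; apply: h; nlia.
Qed.

Lemma corners_chain A m x s p : placed A -> all A (x :: s) -> path below x s ->
  (last x s).1 = m -> tight A m p (x :: s) -> p <= x.1.+1 ->
  sorted below (corners A (x :: s)) /\ all (peel A) (corners A (x :: s)).
Proof.
move=> plA; elim: s x p => [|y s IH] x p // As pt em T px.
have [Ax As'] := andP As; have [xy ys] := andP pt; have [Ay _] := andP As'.
have [_ T'] := T.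
have [IH1 IH2] := IH y x.1.+1 As' ys em T' (ltnW (proj1 (andP xy))).
rewrite cornersE; split.
  case: s {IH IH2 As T pt} As' ys em T' IH1 => //= z s /and3P[_ Az _] /andP[yz _] _ _.
  move=> ->; rewrite andbT.
  have /andP[/andP[a1 a2] /andP[a3 a4]] := corner_bounds A xy.
  have /andP[/andP[b1 b2] /andP[b3 b4]] := corner_bounds A yz.
  by rewrite /below; nlia.
rewrite /= -/(corners A (y :: s)) IH2 andbT.
have [_ _ H2 _ V2] : empty_box (lup A) (lacross A)
    x.1 (corner A x y).1 y.2 (corner A x y).2.
  apply: corner_box => // z Az z1 z2.
  by apply: (tight_between As' pt em T Az); nlia.
have /andP[/andP[a1 a2] /andP[a3 a4]] := corner_bounds A xy.
by rewrite /peel H2 ?V2 //; nlia.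
Qed.

(** * Cycling a chain *)

Definition shifts (s : seq point) : seq point :=
  if s is x :: s' then pairmap (fun x y => (x.1, y.2)) x s' else [::].

(* [cyc A s] is the result of cycling the rows of the chain [s] in [A], except
   that the point in the last column of [s] is left out. *)
Definition cyc (A : pred point) (s : seq point) : pred point :=
  fun q => (q \in shifts s) || (A q && (q \notin s)).

Lemma shifts_below x s : path below x s -> all (fun w => w.2 < x.2) (shifts (x :: s)).
Proof.
elim: s x => //= y s IH x /andP[/andP[_ yx] /IH]; rewrite yx /=.
by apply: sub_all => w; lia.
Qed.

Lemma chain_below x s : path below x s -> all (fun w => w.2 < x.2) s.
Proof.
elim: s x => //= y s IH x /andP[/andP[_ yx] /IH]; rewrite yx /=.
by apply: sub_all => w; lia.
Qed.

(* The point [(x.1, (corner A x y).2)] is [x] itself or a new crossing. *)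
Definition pending A (x : point) s : seq point :=
  if s is y :: _ then [:: (x.1, (corner A x y).2)] else [::].

(** The boxes are flipped from right to left. The [pending] square is the upper left corner of the
    last box flipped: a rook there has been removed, and otherwise it is a new crossing, to be
    absorbed by the next box. The last two clauses keep that next box intact. *)
Lemma flips A m x s p : placed A -> all A (x :: s) -> path below x s ->
    (last x s).1 = m -> tight A m p (x :: s) -> p <= x.1.+1 ->
  exists A2 h v, [/\ config A2 h v,
    forall q, A2 q = (q \in shifts (x :: s)) || (A q && (q \notin s ++ pending A x s)),
    forall q, h q.1 q.2 && v q.1 q.2 =
      [|| q \in shifts (corners A (x :: s)),
          peel A q && (q \notin corners A (x :: s)) |
          (q \in pending A x s) && ~~ A q],
    forall i j, [|| i < x.1, x.2 < j | m < i] -> h i j = lup A i j &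
    forall i j, [|| i <= x.1, x.2 < j | m < i] -> v i j = lacross A i j].
Proof.
move=> plA; elim: s x p => [|y s IH] x p As pt em T px.
  exists A, (lup A), (lacross A); split=> // [|q|q].
  - split; first exact: liveP.
    by move=> i j aij; rewrite (lup_above plA aij) ?(lacross_left plA aij).
  - by rewrite /= andbT.
  - by rewrite /= andbT orbF.
have [Ax As'] := andP As; have [xy ys] := andP pt; have [Ay _] := andP As'.
have [_ T'] := T; have /andP[xy1 xy2] := xy.
have [A2 [h [v [cfg A2E BE hE vE]]]] := IH y x.1.+1 As' ys em T' (ltnW xy1).
have cb := corner_bounds A xy.
have bx0 : empty_box (lup A) (lacross A) x.1 (corner A x y).1 y.2 (corner A x y).2.
  apply: corner_box => // z Az z1 z2.
  by apply: (tight_between As' pt em T Az); nlia.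
have rows_ys := shifts_below ys.
have rows_s := chain_below ys.
have ym : y.1 <= m by rewrite -em below_last.
have corE : (corner A x y).1 = y.1 /\ pending A y s = [::] /\
      shifts (corners A [:: x, y & s]) = [::] /\ corners A (y :: s) = [::] \/
    exists e, [/\ pending A y s = [:: (y.1, e)],
      shifts (corners A [:: x, y & s]) =
        ((corner A x y).1, e) :: shifts (corners A (y :: s)),
      (corner A x y).1 = y.1 \/ e = y.2, e <= y.2 &
      all (fun w => w.2 < y.2) (shifts (corners A (y :: s)))].
  case: s {IH A2E BE rows_ys rows_s} As As' pt ys em T T' => [|z s] As As' pt ys em T T'.
    by left; split=> //; apply: (corner_last plA Ax Ay xy em).
  have yz : below y z by case/andP: ys.
  have Az : A z by case/and3P: As'.
  have cb' : (corner A y z).2 <= y.2 by have := corner_bounds A yz; nlia.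
  right; exists (corner A y z).2; split=> //; first exact: (@corner_meet A m x y z s).
  have [srt _] := @corners_chain A m y (z :: s) x.1.+1 plA As' ys em T' (ltnW xy1).
  by apply: sub_all (shifts_below srt) => w; nlia.
have uy i : A (i, y.2) -> i = y.1.
  by move=> ai; apply: (plA.2 _ _ y.2); rewrite -?surjective_pairing.
have uy' j : A (y.1, j) -> j = y.2.
  by move=> ai; apply: (plA.1 y.1); rewrite -?surjective_pairing.
have [b [d xqE]] : exists b d, corner A x y = (b, d).
  by case: (corner A x y) => b d; exists b, d.
have -> : pending A x (y :: s) = [:: (x.1, d)] by rewrite /pending xqE.
have -> : corners A [:: x, y & s] = (b, d) :: corners A (y :: s).
  by rewrite cornersE xqE.
have -> : shifts [:: x, y & s] = (x.1, y.2) :: shifts (y :: s) by [].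
rewrite cornersE xqE /= -/(corners A (y :: s)) -/(shifts (_ :: _)) in bx0 cb corE.
have /andP[/andP[xb yb] /andP[yd dx]] := cb.
have rows0 (q : point) : q.2 < y.2 -> [/\ q != (x.1, d), q != (b, y.2) & q != (b, d)].
  by move=> lt; split; apply/eqP => e; move: lt; rewrite e /= ?ltnn // ltnNge ltnW.
have rsh (q : point) : q \in shifts (y :: s) -> q.2 < y.2.
  by move=> hq; have /allP := rows_ys; apply.
(* Where neighbouring boxes touch, the only rook to remove is [y], by [corner_meet]. *)
have pe_y q : A q -> (q \in pending A y s) || (q == (b, y.2)) = (q == y).
  move=> Aq; apply/orP/eqP => [[]|->].
  - case: corE => [[_ [-> _]] //|[e [-> _ _ _ _]]].
    rewrite inE => /eqP qe; move: Aq; rewrite qe => /uy'->.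
    by rewrite -surjective_pairing.
  - by move/eqP=> qe; move: Aq; rewrite qe => /uy->; rewrite -surjective_pairing.
  - case: corE => [[-> _]|[e [-> _ [->|->] _ _]]]; rewrite ?inE -?surjective_pairing;
      by auto.
(* The earlier flips only changed sides in columns from [y.1] on and in rows up to [y.2], none of
   which matters for this box. *)
have bx : empty_box h v x.1 b y.2 d.
  case: bx0 => [[ab cd] H1 H2 V1 V2]; split=> // [i j hi hj hij|j hj|i j hi hj hij|i hi].
  - by rewrite hE ?H1 //; nlia.
  - by rewrite hE ?H2 //; nlia.
  - by rewrite vE ?V1 //; nlia.
  - by rewrite vE ?V2 //; nlia.
have [cfg2 BE2] := flip_config cfg bx.
exists (flip A2 x.1 b y.2 d), (flip_up h x.1 b y.2 d), (flip_across v x.1 b y.2 d).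
split=> // [q|q|i j hij|i j hij].
- rewrite /flip A2E !inE !mem_cat !inE.
  have [//|_] := eqVneq q (x.1, y.2).
  have [/rsh/rows0[-> -> _] //|_] := boolP (q \in shifts (y :: s)).
  have [Aq|_] := boolP (A q); last by [].
  rewrite /= -(pe_y q Aq); case: (q \in s); case: (q \in pending A y s) => //=;
    by case: (q == (b, y.2)); case: (q == (x.1, d)).
- rewrite BE2 andbA BE A2E.
  have high (z : point) : y.2 <= z.2 ->
      (z \in shifts (y :: s)) = false /\ (z \in s) = false.
    move=> yz; split; apply/negP.
      by move/rsh; rewrite ltnNge yz.
    by have /allP h0 := rows_s; move/h0; rewrite ltnNge yz.
  have -> : (q == (x.1, d)) && ~~ ((q \in shifts (y :: s)) ||
      A q && (q \notin s ++ pending A y s)) = (q == (x.1, d)) && ~~ A q.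
    have [->|//] := eqVneq q (x.1, d); rewrite mem_cat.
    have [-> ->] := high (x.1, d) (ltnW yd).
    suff /negbTE -> : (x.1, d) \notin pending A y s by rewrite /= andbT.
    case: corE => [[_ [-> _]] //|[e [-> _ _ _ _]]].
    by rewrite inE xpair_eqE negb_and ltn_eqF.
  have -> : (q == (b, y.2)) && ~~ ((q \in shifts (y :: s)) ||
      A q && (q \notin s ++ pending A y s)) =
      (q == (b, y.2)) && (~~ A q || (q \in pending A y s)).
    have [->|//] := eqVneq q (b, y.2); rewrite mem_cat.
    have [-> ->] := high (b, y.2) (leqnn _).
    by rewrite /= negb_and negbK.
  have Ayy : A (y.1, y.2) by rewrite -surjective_pairing.
  case: corE => [[by1 [-> [-> ->]]]|[e [-> -> meet ey srows]]].
    have -> : (q == (b, y.2)) && (~~ A q || (q \in [::])) = false.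
      by have [->|//] := eqVneq q (b, y.2); rewrite by1 Ayy.
    by rewrite !inE /= !orbF !andbT.
  (* One of the two squares is [y]; together they contribute the single crossing [(b, e)], the shift
     between two consecutive corners. *)
  have mid : [|| [&& q \in [:: (y.1, e)], ~~ A q & q != (b, d)] |
       (q == (b, y.2)) && (~~ A q || (q \in [:: (y.1, e)]))] = (q == (b, e)).
    have ne_d : (b, e) != (b, d).
      by rewrite xpair_eqE eqxx /= ltn_eqF // (leq_ltn_trans ey).
    rewrite !inE; case: (eqVneq e y.2) meet => [-> _|ney [by1|/eqP]]; last by rewrite (negbTE ney).
      have [->|_] := eqVneq q (b, y.2).
        case Ab: (A (b, y.2)); last by rewrite /= orbT.
        by rewrite (uy _ Ab) eqxx orbT.
      by have [->|//] := eqVneq q (y.1, y.2); rewrite Ayy.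
    rewrite by1 in ne_d *.
    have -> : (q == (y.1, y.2)) && (~~ A q || (q == (y.1, e))) = false.
      have [->|//] := eqVneq q (y.1, y.2).
      by rewrite Ayy xpair_eqE eqxx eq_sym (negbTE ney).
    have [->|//] := eqVneq q (y.1, e).
    rewrite orbF ne_d; case Ae: (A (y.1, e)) => //.
    by rewrite (uy' _ Ae) eqxx in ney.
  rewrite !inE -{}mid negb_or !inE.
  have sc_d : q \in shifts (corners A (y :: s)) -> q != (b, d).
    have /allP h0 := srows; by move/h0/rows0 => [].
  move: sc_d; case: (q \in shifts _) => [->//|_]; last first.
    by case: (q == (b, d)); case: (q == (x.1, d)); case: (q == (b, y.2));
       case: (q == (y.1, e)); case: (A q); case: (peel A q);
       case: (q \in corners A (y :: s)).
  by rewrite //= orbT.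
- rewrite /flip_up; case: ifP => [jj|_]; last by apply: hE; nlia.
  have -> : (i == x.1) = false by nlia.
  have -> : (i == b) = false by nlia.
  by apply: hE; nlia.
- rewrite /flip_across; case: ifP => [jj|_]; last by apply: vE; nlia.
  have -> : (j == y.2) = false by nlia.
  have -> : (j == d) = false by nlia.
  by apply: vE; nlia.
Qed.

Definition agree_outside A A' m n :=
  forall i j, (n < j) || (m < i) ->
  lup A' i j = lup A i j /\ lacross A' i j = lacross A i j.

Lemma corners_last A m x y s p : placed A ->
  all A [:: x, y & s] -> path below x (y :: s) -> (last y s).1 = m ->
  tight A m p [:: x, y & s] ->
  (last (corner A x y) (corners A (y :: s))).1 = m.
Proof.
move=> plA; elim: s x y p => [|z s IH] x y p /and3P[Ax Ay As] /andP[xy ys] em T.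
  by rewrite -[RHS]em; apply: (corner_last plA Ax Ay xy em (proj2 T)).
by apply: (IH y z x.1.+1) => //; [apply/andP|exact: (proj2 T)].
Qed.

(** By [corner_first] the final pending square is the rook [x], so no crossing is left over besides
    the cycled corners. *)
Lemma peel_cyc A A' m x y s : placed A ->
  all A [:: x, y & s] -> path below x (y :: s) -> (last y s).1 = m ->
  tight A m 0 [:: x, y & s] -> A' =1 cyc A [:: x, y & s] ->
  peel A' =1 cyc (peel A) (corners A [:: x, y & s]) /\
  agree_outside A A' m x.2.
Proof.
move=> plA As pt em T A'E; have Ax : A x by case/andP: As.
have [A2 [h [v [[cfg _] A2E BE hE vE]]]] := flips plA As pt em T (leq0n _).
have px : pending A x (y :: s) = [:: x].
  by rewrite /pending (corner_first plA As pt em T) -surjective_pairing.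
rewrite px in A2E BE.
have [|eh ev] := growth_unique (liveP A') cfg.
  move=> q; rewrite A'E A2E /cyc mem_cat !inE; congr (_ || _ && ~~ _).
  by case: (q == x); case: (q == y); case: (q \in s).
split=> [q|i j ij].
  rewrite /peel eh ev BE /cyc; congr (_ || _).
  have -> : (q \in [:: x]) && ~~ A q = false; last exact: orbF.
  by rewrite inE; have [->|//] := eqVneq q x; rewrite Ax.
by rewrite eh ev hE ?vE //; move: ij; lia.
Qed.

(** Passing to the corners shortens the chain by one and keeps its top row and last column. After
    [n] levels it is the single point [(m, x.2)], which [cyc] deletes. *)
Lemma cyc_levels n A A' m x s : size s = n -> placed A ->
  all A (x :: s) -> path below x s -> (last x s).1 = m ->
  tight A m 0 (x :: s) -> A' =1 cyc A (x :: s) ->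
  [/\ forall l, l < n ->
        agree_outside (iter l peel A) (iter l peel A') m x.2,
      iter n peel A (m, x.2) &
      iter n peel A' =1 (fun q => iter n peel A q && (q != (m, x.2)))].
Proof.
elim: n A A' x s => [|n IH] A A' x [|y s] //.
  move=> _ plA /andP[Ax _] _ <- _ A'E; rewrite /= -surjective_pairing.
  by split=> // q; rewrite A'E /cyc /= inE.
move=> [sn] plA As pt em T A'E.
have [BE agr] := peel_cyc plA As pt em T A'E.
have [srt BB] := corners_chain plA As pt em T (leq0n _).
have T' := tight_peel plA As pt em T (or_introl (conj erefl erefl)).
have em' := corners_last plA As pt em T.
have q2 := corner_first plA As pt em T.
rewrite cornersE in BE srt BB T'.
have := IH (peel A) (peel A') (corner A x y) (corners A (y :: s)).
rewrite size_corners q2; case=> //; first exact: peel_placed.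
move=> H1 H2 H3; split=> [[|l] ll //||q]; rewrite -?iterS ?iterSr //.
  exact: H1.
Qed.

(** * Colours *)

(* Fomin's local rule with colours [1, ..., M] (0: no line), except that colour
   [M] is followed by colour [1]. *)
Definition color_cell M (a : bool) (x y : nat) : nat * nat :=
  if a then (1, 1) else
  if (x == y) && (0 < x) then
    let z := if x == M then 1 else x.+1 in (z, z)
  else (x, y).

Definition cup M := up 0 (color_cell M).
Definition cacross M := across 0 (color_cell M).
Arguments cup : simpl never.
Arguments cacross : simpl never.

Lemma color_cell_sym M a x y :
  color_cell M a y x = ((color_cell M a x y).2, (color_cell M a x y).1).
Proof.
by rewrite /color_cell eq_sym; case: a => //; case: eqVneq => [->|] //=; case: ifP.
Qed.

Lemma colorP M A : growth 0 (color_cell M) A (cup M A) (cacross M A).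
Proof. exact: growthP. Qed.

Lemma cup_swap M A i j : cup M (swap A) i j = cacross M A j i.
Proof.
have [e _] := growth_unique (growth_swap (@color_cell_sym M) (colorP M A))
  (colorP M (swap A)) (fun _ => erefl).
by rewrite -e.
Qed.

Lemma cacross_swap M A i j : cacross M (swap A) i j = cup M A j i.
Proof.
have [_ e] := growth_unique (growth_swap (@color_cell_sym M) (colorP M A))
  (colorP M (swap A)) (fun _ => erefl).
by rewrite -e.
Qed.

(** Colour [m.+1] stands for a line of level [m], and 0 for no line; so at most one level below [M]
    is live. *)
Definition shows M (x : nat) (l : nat -> bool) :=
  x <= M /\ forall m, m < M -> (x == m.+1) = l m.

Lemma shows_inj M x y l l' : shows M x l -> shows M y l' ->
  (forall m, m < M -> l m = l' m) -> x = y.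
Proof.
move=> [xM xl] [yM yl] ll'.
case: x xM xl => [|x] xM xl; case: y yM yl => [|y] yM yl //.
- by have := xl y yM; rewrite ll' // -yl // eqxx.
- by have := xl x xM; rewrite ll' // -yl // eqxx.
- by have := xl x xM; rewrite ll' // -yl // eqxx => /esym /eqP ->.
Qed.

(** [P m] tells whether the square is a point of level [m]. That [P M] fails excludes a meeting of
    two lines of colour [M], the exceptional case of the rule. *)
Lemma color_cell_shows M a x y lx ly (P : nat -> bool) : 0 < M ->
  shows M x lx -> shows M y ly ->
  P 0 = a -> (forall m, m < M -> P m.+1 = lx m && ly m) -> ~~ P M ->
  (a -> forall m, lx m = false /\ ly m = false) ->
  shows M (color_cell M a x y).1 (fun m => (live_cell (P m) (lx m) (ly m)).1) /\
  shows M (color_cell M a x y).2 (fun m => (live_cell (P m) (lx m) (ly m)).2).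
Proof.
move=> M0 [xM xl] [yM yl] Pa PS PM dead; rewrite /color_cell.
case: a Pa dead => Pa dead.
  split; split=> //= m mM; have [-> ->] := dead isT m;
    case: m mM => [|m] mM; rewrite ?Pa // PS ?(ltnW mM) //;
    by have [-> ->] := dead isT m.
case: ifP => [/andP[/eqP e x0]|ne].
  case: x x0 xM xl e => // t _ tM xl e; subst y.
  have lt m : m < M -> lx m = (t == m) by move=> mM; rewrite -xl.
  have lt' m : m < M -> ly m = (t == m) by move=> mM; rewrite -yl.
  have [e|nM] := eqVneq t.+1 M.
    by move: PM; rewrite -e PS ?lt ?lt' ?eqxx //; lia.
  have PE m : m < M -> P m = (t.+1 == m).
    by case: m => [|m] mM; rewrite ?Pa // PS ?lt ?lt' ?andbb //; lia.
  split; split=> /=; try lia; move=> m mM; rewrite PE // lt // lt' //;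
    by rewrite /live_cell !eqSS; have [<-|_] := eqVneq t m; rewrite ?(gtn_eqF (ltnSn t)) //; case: eqP.
have PE m : m < M -> P m = false /\ lx m && ly m = false.
  have E l : l < M -> lx l && ly l = false.
    move=> lM; rewrite -xl // -yl //; apply/negP => /andP[/eqP ex /eqP ey].
    by move: ne; rewrite ex ey eqxx.
  by case: m => [|m] mM; split; rewrite ?E // ?PS ?E //; lia.
by split; split=> //= m mM; rewrite /live_cell; have [-> ->] := PE m mM;
  rewrite /= ?xl ?yl.
Qed.

Lemma level_source A m i d : placed A -> iter m peel A (i, d) ->
  exists2 d', d' <= d & A (i, d').
Proof.
move=> plA; elim: m d => [|m IH] d /=; first by exists d.
case/andP=> /lup_source[e [/= ed /IH[d' d'e ad']] _] _.
by exists d' => //; lia.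
Qed.

Lemma level_lup A m i j : placed A -> A (i, j) -> lup (iter m peel A) i j = false.
Proof.
move=> plA aij; apply/negP => /lup_source[d [dj /(level_source plA)[d' dd' ad'] _]].
by have := plA.1 _ _ _ aij ad'; lia.
Qed.

Lemma iter_peel_swap A m q :
  iter m peel (swap A) q = iter m peel A (q.2, q.1).
Proof.
elim: m q => [|m IH] //= q.
rewrite (peel_ext IH) -peel_swap; exact: peel_ext.
Qed.

Lemma level_lacross A m i j : placed A -> A (i, j) ->
  lacross (iter m peel A) i j = false.
Proof.
move=> plA aij; have := @level_lup _ m j i (placed_swap plA) aij.
have [e _] := growth_unique (liveP (iter m peel (swap A)))
  (liveP (swap (iter m peel A))) (iter_peel_swap A m).
by rewrite /lup in e; rewrite /lup e -[up _ _ _ _ _]/(lup _ _ _) lup_swap.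
Qed.

(** The lower side of [(i, j)] is the upper side of [(i, j.-1)], so membership in [Z] is asked of
    the latter square; this covers the sides on the border of [Z]. *)
Lemma color_levels M A A2 (Z : pred point) : 0 < M -> placed A ->
  (forall i j, Z (i.+1, j) -> Z (i, j)) -> (forall i j, Z (i, j.+1) -> Z (i, j)) ->
  (forall q, Z q -> A2 q = A q) -> (forall q, Z q -> ~~ iter M peel A q) ->
  (forall i j, (0 < j -> Z (i, j.-1)) ->
     shows M (cup M A2 i j) (fun m => lup (iter m peel A) i j)) /\
  (forall i j, (0 < i -> Z (i.-1, j)) ->
     shows M (cacross M A2 i j) (fun m => lacross (iter m peel A) i j)).
Proof.
move=> M0 plA Zl Zd AA2 noP; have [c0 r0 G] := colorP M A2.
pose U i j := shows M (cup M A2 i j) (fun m => lup (iter m peel A) i j).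
pose R i j := shows M (cacross M A2 i j) (fun m => lacross (iter m peel A) i j).
have cell i j : Z (i, j) -> U i j -> R i j -> U i j.+1 /\ R i.+1 j.
  move=> Zij Uij Rij.
  have [] := @color_cell_shows M (A (i, j)) _ _ _ _ 
    (fun m => iter m peel A (i, j)) M0 Uij Rij.
  - by [].
  - by move=> m _.
  - exact: noP.
  - by move=> aij m; rewrite level_lup ?level_lacross.
  rewrite -(AA2 _ Zij) -G /= => -[s1 t1] [s2 t2].
  by split; split=> // m mM; rewrite ?t1 ?t2 // ?lupS ?lacrossS.
have U0 i : U i 0 by rewrite /U c0; split=> // m _; rewrite /lup /up.
have R0 j : R 0 j.
  by rewrite /R r0; split=> // m _; rewrite /lacross /across.
have all_ij i j : Z (i, j) -> U i j /\ R i j.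
  have [m] := ubnP (i + j); elim: m i j => // m IH i j lt Zij; split.
    case: j lt Zij => // j lt Zij; have Z' := Zd _ _ Zij.
    by have [|u r] := IH i j _ Z'; [lia|case: (cell _ _ Z' u r)].
  case: i lt Zij => // i lt Zij; have Z' := Zl _ _ Zij.
  by have [|u r] := IH i j _ Z'; [lia|case: (cell _ _ Z' u r)].
split=> i j h.
  case: j h => [|j] h; first exact: U0.
  by have [u r] := all_ij _ _ (h isT); case: (cell _ _ (h isT) u r).
case: i h => [|i] h; first exact: R0.
by have [u r] := all_ij _ _ (h isT); case: (cell _ _ (h isT) u r).
Qed.

(** Each level adds a point: [peel_lift] keeps the length and stays below the first row, so the rook
    left of the first crossing can be put in front. *)
Lemma iter_peel_lift A m p t : placed A -> path below p t ->
  all (iter m peel A) (p :: t) ->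
  exists c, [/\ size c = size (p :: t) + m, all A c, sorted below c &
    all (fun z => (z.1 <= (last p t).1) && (z.2 <= p.2)) c].
Proof.
move=> plA; elim: m p t => [|m IH] p t pt Bt.
  exists (p :: t); split=> //; first by rewrite addn0.
  apply/andP; split; first by rewrite leqnn andbT below_last.
  elim: t p pt {Bt} => //= y t IHt p /andP[/andP[_ py] yt].
  rewrite below_last // ltnW //=; apply: sub_all (IHt y yt) => z; lia.
have plm := iter_peel_placed m plA.
have [c [sc Bc stc bc]] := peel_lift plm pt Bt.
have /andP[/andP[_ /lacross_source[l [lp Bl _]]] _] := Bt.
have lc : path below (l, p.2) c.
  case: c stc bc {sc Bc} => //= z c -> /andP[bz _]; rewrite andbT /below /=; lia.
have [|c' [sc' Ac' sorted_c' bc']] := IH (l, p.2) c lc; first by apply/andP.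
exists c'; split=> //; first by rewrite sc' /= sc /= addnS.
apply: sub_all bc' => z /= /andP[z1 z2]; rewrite z2 andbT.
apply: leq_trans z1 _; case: c bc sc {Bc stc lc IH sc'} => // z' c /allP bc _.
by have /and3P[_ _] := bc _ (mem_last z' c).
Qed.

(** Two colours 1 come from a rook, two equal higher colours from a meeting one colour lower, and
    everything else passes unchanged. Only a meeting of colours [M] would be ambiguous. *)
Lemma color_cell_inj M (a b : bool) x y x' y' : x <= M -> x' <= M ->
  (a -> x = 0 /\ y = 0) -> (b -> x' = 0 /\ y' = 0) ->
  (x == M) && (y == M) = false -> (x' == M) && (y' == M) = false ->
  color_cell M a x y = color_cell M b x' y' -> [/\ a = b, x = x' & y = y'].
Proof.
move=> xM xM' ha hb nx nx'; rewrite /color_cell.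
case: a ha => [/(_ isT)[-> ->]|_]; case: b hb => [/(_ isT)[-> ->]|_] //;
  repeat (case: ifP => ? /=); move=> e;
  move: (congr1 fst e) (congr1 snd e) => /= ? ?; split=> //; lia.
Qed.

Definition down_closed (F : pred point) :=
  (forall i j, F (i.+1, j) -> F (i, j)) /\ (forall i j, F (i, j.+1) -> F (i, j)).

Lemma down_closed_le F i j i' j' : down_closed F -> F (i', j') ->
  i <= i' -> j <= j' -> F (i, j).
Proof.
move=> [Fl Fd] h ii jj.
have {}h : F (i, j').
  elim: i' ii h => [|i' IH]; rewrite leq_eqVlt => /predU1P[-> //|] // lt /Fl.
  exact: IH.
elim: j' jj h => [|j' IH]; rewrite leq_eqVlt => /predU1P[-> //|] // lt /Fd.
exact: IH.
Qed.

Definition no_chain (F A : pred point) k :=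
  forall x s, size (x :: s) = k -> all A (x :: s) -> path below x s ->
    F ((last x s).1, x.2) -> False.

Definition same_border M (F A A' : pred point) :=
  forall i j, F (i, j) ->
    (~~ F (i, j.+1) -> cup M A' i j.+1 = cup M A i j.+1) /\
    (~~ F (i.+1, j) -> cacross M A' i.+1 j = cacross M A i.+1 j).

Lemma avoid_levels M F A : down_closed F -> placed A -> no_chain F A M.+1 ->
  forall q, F q -> ~~ iter M peel A q.
Proof.
move=> Fdc plA noc q Fq; apply/negP => Bq.
have [|c [sc Ac pc bc]] := @iter_peel_lift A M q [::] plA isT; first by rewrite /= Bq.
case: c sc Ac pc bc => // z c sc Ac pc bc; apply: (noc z c) => //.
have /allP bc' := bc.
have /andP[h1 _] := bc' _ (mem_last z c); have /andP[_ h2] := bc' _ (mem_head z c).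
by apply: (down_closed_le Fdc (i' := q.1) (j' := q.2)); rewrite -?surjective_pairing.
Qed.

(** * Border colours under one cycling step *)

Section Invariance.

Variables (M : nat) (F A A2 : pred point) (x : point) (s : seq point).
Let m := (last x s).1.
Let n := x.2.

Hypotheses (M0 : 0 < M) (Fdc : down_closed F) (plA : placed A) (plA2 : placed A2).
Hypotheses (sM : size s = M) (As : all A (x :: s)) (xs : path below x s).
Hypotheses (Fmn : F (m, n)) (T : tight A m 0 (x :: s)).
Hypothesis low : no_chain (fun q => F q && (q.2 < n)) A M.+1.
Hypothesis A2E : forall q, A2 q = cyc A (x :: s) q || (q == (m, n)).

Let A' := cyc A (x :: s).
Let Z : pred point := fun q => F q && ((q.2 < n) || (q.2 == n) && (q.1 < m)).

Let levels : [/\ forall l, l < M ->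
        agree_outside (iter l peel A) (iter l peel A') m n,
      iter M peel A (m, n) &
      iter M peel A' =1 (fun q => iter M peel A q && (q != (m, n)))].
Proof. exact: (cyc_levels sM plA As xs erefl T (fun _ => erefl)). Qed.

Let Zl i j : Z (i.+1, j) -> Z (i, j).
Proof. by case: Fdc => Fl _ /andP[/Fl Fij h]; rewrite /Z Fij /=; move: h => /=; lia. Qed.

Let Zd i j : Z (i, j.+1) -> Z (i, j).
Proof. by case: Fdc => _ Fd /andP[/Fd Fij h]; rewrite /Z Fij /=; move: h => /=; lia. Qed.

(** Below row [n] this follows from [low]. In row [n] level [M] has at most one point, and that is
    [(m, n)]. *)
Let noZ q : Z q -> ~~ iter M peel A q.
Proof.
case/andP=> Fq; have [lt _|_] := ltnP q.2 n.
  apply: (@avoid_levels M (fun q => F q && (q.2 < n))) => //; last by rewrite Fq.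
  case: Fdc => Fl Fd; split=> i j /andP[h1 h2]; apply/andP; split=> //=.
  - exact: Fl h1.
  - exact: Fd h1.
  - by move: h2 => /=; lia.
move=> /andP[/eqP q2 q1]; apply/negP => Bq; have [_ Bm _] := levels.
have := (iter_peel_placed M plA).2 q.1 m n; rewrite -{1}q2 -surjective_pairing.
by move=> /(_ Bq Bm) e; rewrite e ltnn in q1.
Qed.

Let noZ' q : Z q -> ~~ iter M peel A' q.
Proof. by move=> Zq; have [_ _ ->] := levels; rewrite (negbTE (noZ Zq)). Qed.

Let box_s : all (fun w => (w.1 <= m) && (w.2 <= n)) (x :: s).
Proof.
rewrite /m /n /= leqnn andbT below_last //=.
elim: s x xs => //= y t IH z /andP[/andP[_ zy] yt]; rewrite below_last // ltnW //=.
by apply: sub_all (IH y yt) => w; lia.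
Qed.

Let box_shifts : all (fun w => (w.1 <= m) && (w.2 <= n)) (shifts (x :: s)).
Proof.
move: box_s; rewrite /shifts; elim: s x => //= y t IH z /and3P[/andP[z1 z2] yb tb].
by rewrite z1 (andP yb).2 /= IH //= yb.
Qed.

Let outside q : (m < q.1) || (n < q.2) -> A2 q = A q.
Proof.
move=> out; rewrite A2E /cyc.
have out' t : all (fun w => (w.1 <= m) && (w.2 <= n)) t -> q \notin t.
  move=> /allP h; apply/negP => /h; rewrite leqNgt [q.2 <= n]leqNgt.
  by case/orP: out => ->; rewrite ?andbF.
rewrite (negbTE (out' _ box_shifts)) (out' _ box_s) andbT orFb.
have [e|_] := eqVneq q (m, n); last exact: orbF.
by move: out; rewrite e /= !ltnn.
Qed.

Let A2Z q : Z q -> A2 q = A' q.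
Proof.
move=> Zq; rewrite A2E; have [e|_] := eqVneq q (m, n); last exact: orbF.
by move: Zq; rewrite /Z e /= !ltnn andbF andbF.
Qed.

Let plA' : placed A'.
Proof.
have sub q : A' q -> A2 q by rewrite A2E /A' => ->.
by case: plA2 => h1 h2; split=> i j k /sub h /sub; [apply: h1|apply: h2].
Qed.

Let upA := color_levels M0 plA Zl Zd (fun _ _ => erefl) noZ.
Let upA2 := color_levels M0 plA' Zl Zd A2Z noZ'.

Let cup_eq i j : (0 < j -> Z (i, j.-1)) -> (n < j) || (m < i) ->
  cup M A2 i j = cup M A i j.
Proof.
move=> h out; apply: shows_inj (upA2.1 _ _ h) (upA.1 _ _ h) _ => l lM.
by have [agr _ _] := levels; case: (agr l lM i j out).
Qed.

Let cacross_eq i j : (0 < i -> Z (i.-1, j)) -> (n < j) || (m < i) ->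
  cacross M A2 i j = cacross M A i j.
Proof.
move=> h out; apply: shows_inj (upA2.2 _ _ h) (upA.2 _ _ h) _ => l lM.
by have [agr _ _] := levels; case: (agr l lM i j out).
Qed.

Let Fle i j i' j' := @down_closed_le F i j i' j' Fdc.

(** In [A] two lines of colour [M] meet at [(m, n)] and continue with colour 1; in [A2] a rook
    stands there and emits colour 1. *)
Let corner_cell : cup M A m n.+1 = cup M A2 m n.+1 /\
  cacross M A m.+1 n = cacross M A2 m.+1 n.
Proof.
have [_ _ G] := colorP M A; have [_ _ G2] := colorP M A2.
have hu : 0 < n -> Z (m, n.-1).
  by move=> n0; rewrite /Z (Fle Fmn) ?leq_pred //= prednK // leqnn.
have ha : 0 < m -> Z (m.-1, n).
  by move=> m0; rewrite /Z (Fle Fmn) ?leq_pred //= eqxx prednK // leqnn orbT.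
have [uM uE] := upA.1 _ _ hu; have [aM aE] := upA.2 _ _ ha.
have [_ Bmn _] := levels.
have M1 : M.-1 < M by rewrite prednK.
have /andP[/= lu la] : peel (iter M.-1 peel A) (m, n) by rewrite -iterS prednK.
have cM : cup M A m n = M by have := uE _ M1; rewrite lu prednK // => /eqP.
have rM : cacross M A m n = M by have := aE _ M1; rewrite la prednK // => /eqP.
have Amn : A (m, n) = false.
  by apply/negP => a; have := level_lup M.-1 plA a; rewrite lu.
have := G m n; have := G2 m n; rewrite cM rM Amn A2E eqxx orbT /color_cell /=.
by rewrite eqxx M0 /= => -[-> ->] [-> ->].
Qed.

Let row_n i : F (i, n) -> [/\ cup M A2 i n.+1 = cup M A i n.+1 &
  m <= i -> cacross M A2 i.+1 n = cacross M A i.+1 n].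
Proof.
move=> Fi; case: (ltngtP i m) => [im|mi|->]; last by have [-> ->] := corner_cell.
  split=> [|//]; apply: cup_eq; last by rewrite leqnn.
  by move=> _; rewrite /Z /= Fi eqxx im orbT.
have [//||||||? ? ? ?] := @growth_propagate _ 0 (color_cell M)
    (fun q => F q && (q.2 == n)) m.+1 n A2 A _ _ _ _
    (colorP M A2) (colorP M A) _ _ _ _ _ i n mi (leqnn n).
all: try by rewrite /= Fi eqxx.
- by move=> i' j' _ /andP[/Fdc.1 /= -> /= ->].
- by move=> i' j' nj /andP[_ /= /eqP e]; move: nj; rewrite -e ltnn.
- by move=> i' j' mi' nj _; apply: outside; rewrite /= mi'.
- move=> i' mi' /andP[Fi' _]; apply: cup_eq; last by rewrite mi' orbT.
  by move=> n0; rewrite /Z (Fle Fi') ?leq_pred //= prednK // leqnn.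
- by move=> j' nj /andP[_ /eqP /= ->]; have [_ ->] := corner_cell.
- by split.
Qed.

(** Since [(m, n)] is in [F], border sides in rows below [n] lie right of column [m], where all
    levels agree. Above row [n] the placements coincide and equal colours propagate. *)
Theorem cycle_border : same_border M F A A2.
Proof.
move=> i j Fij; case: (ltngtP j n) => [jn|nj|ejn]; last first.
- move: Fij; rewrite {}ejn => Fij; have [h1 h2] := row_n Fij; split=> // nF.
  by apply: h2; rewrite leqNgt; apply: contra nF => im; apply: Fle Fmn _ _.
- have [|||||? ? ? ?] := @growth_propagate _ 0 (color_cell M)
    F 0 n.+1 A2 A _ _ _ _ (colorP M A2) (colorP M A) _ _ _ _ _ i j (leq0n _) nj Fij => //.
  + by move=> i' j' _; apply: Fdc.1.
  + by move=> i' j' _; apply: Fdc.2.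
  + by move=> i' j' _ nj' _; apply: outside; rewrite /= nj' orbT.
  + by move=> i' _ /Fdc.2 /row_n[].
split=> nF.
  apply: cup_eq; first by move=> _; rewrite /Z /= Fij jn.
  by rewrite orbC ltnNge; apply/orP; left; apply: contra nF => im; apply: Fle Fmn _ _.
apply: cacross_eq; first by move=> _; rewrite /Z /= Fij jn.
rewrite orbC ltnS leqNgt; apply/orP; left; apply: contra nF => im; apply: Fle Fmn _ _ => //.
exact: ltnW.
Qed.

End Invariance.

(** The rule is run backwards from the border by [color_cell_inj]: the upper and right colours of a
    square are known from the border or from the next square. *)
Lemma border_inj M F A B N : 0 < M -> down_closed F -> placed A -> placed B ->
  (forall q, F q -> q.1 < N /\ q.2 < N) ->
  no_chain F A M.+1 -> no_chain F B M.+1 -> same_border M F A B ->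
  forall q, F q -> A q = B q.
Proof.
move=> M0 Fdc plA plB FN nA nB brd.
have noA := avoid_levels Fdc plA nA; have noB := avoid_levels Fdc plB nB.
have [Fl Fd] := Fdc.
have [uA aA] := color_levels M0 plA Fl Fd (fun _ _ => erefl) noA.
have [uB aB] := color_levels M0 plB Fl Fd (fun _ _ => erefl) noB.
have [_ _ GA] := colorP M A; have [_ _ GB] := colorP M B.
have rook C i j : placed C -> no_chain F C M.+1 -> F (i, j) ->
    [/\ cup M C i j <= M, C (i, j) -> cup M C i j = 0 /\ cacross M C i j = 0 &
      (cup M C i j == M) && (cacross M C i j == M) = false].
  move=> plC nC Fij; have noC := avoid_levels Fdc plC nC.
  have [uC aC] := color_levels M0 plC Fl Fd (fun _ _ => erefl) noC.
  have hu : 0 < j -> F (i, j.-1) by case: j Fij => // j /Fd.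
  have ha : 0 < i -> F (i.-1, j) by case: i Fij {hu} => // i /Fl.
  have [uM uE] := uC _ _ hu; have [aM aE] := aC _ _ ha; split=> // [cij|].
    split.
      case e: (cup M C i j) uM uE => [|c] // cM /(_ c cM).
      by rewrite eqxx level_lup.
    case e: (cacross M C i j) aM aE => [|c] // cM /(_ c cM).
    by rewrite eqxx level_lacross.
  apply/negP => /andP[/eqP e1 /eqP e2].
  have M1 : M.-1 < M by rewrite prednK.
  have := noC _ Fij; rewrite -(prednK M0) iterS /peel /= -uE // -aE // e1 e2.
  by rewrite prednK // eqxx.
have main i j : F (i, j) -> [/\ A (i, j) = B (i, j),
    cup M A i j = cup M B i j & cacross M A i j = cacross M B i j].
  have [d] := ubnP (N - i + (N - j)); elim: d i j => // d IH i j lt Fij.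
  have [iN jN] := FN _ Fij; move: iN jN => /= iN jN.
  have eu : cup M A i j.+1 = cup M B i j.+1.
    case FS: (F (i, j.+1)); last by case: (brd i j Fij) => <- //; rewrite FS.
    by have [|_ -> _] := IH i j.+1 _ FS; first lia.
  have ea : cacross M A i.+1 j = cacross M B i.+1 j.
    case FS: (F (i.+1, j)); last by case: (brd i j Fij) => _ <- //; rewrite FS.
    by have [|_ _ ->] := IH i.+1 j _ FS; first lia.
  have [a1 a2 a3] := rook A i j plA nA Fij; have [b1 b2 b3] := rook B i j plB nB Fij.
  by apply: (color_cell_inj a1 b1 a2 b2 a3 b3); rewrite -GA -GB eu ea.
by case=> i j /main[].
Qed.

(** * Placements as sets of pairs *)

Lemma cup_ext M A A' i j : A =1 A' -> cup M A i j = cup M A' i j.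
Proof. by move=> e; have [h _] := growth_unique (colorP M A) (colorP M A') e; apply: h. Qed.

Lemma cacross_ext M A A' i j : A =1 A' -> cacross M A i j = cacross M A' i j.
Proof. by move=> e; have [_ h] := growth_unique (colorP M A) (colorP M A') e; apply: h. Qed.

Lemma same_border_trans M F A B C :
  same_border M F A B -> same_border M F B C -> same_border M F A C.
Proof.
by move=> h1 h2 i j Fij; have [a b] := h1 i j Fij; have [c d] := h2 i j Fij;
   split=> nF; rewrite ?c ?d ?a ?b.
Qed.

Lemma same_border_swap M F A B : same_border M F A B ->
  same_border M (swap F) (swap A) (swap B).
Proof.
move=> h i j Fij; have [h1 h2] := h j i Fij.
by split=> nF; rewrite ?cup_swap ?cacross_swap ?h1 ?h2.
Qed.

Lemma no_chain_swap F A k : no_chain F A k ->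
  no_chain (swap F) (swap A) k.
Proof.
move=> noc x s sk As xs Fe; pose sw (q : point) := (q.2, q.1).
case: (lastP s) sk As xs Fe => [|t z] sk As xs Fe.
  by apply: (noc (sw x) [::]) => //=; case/andP: As => ->.
rewrite last_rcons /= in Fe.
apply: (noc (sw z) (rcons (rev (map sw t)) (sw x))); last by rewrite last_rcons.
- by rewrite /= size_rcons size_rev size_map -sk /= size_rcons.
- move: As; rewrite /= all_rcons => /and3P[Ax Az At]; rewrite all_rcons Ax Az /=.
  by rewrite all_rev all_map.
- have : sorted (fun u v => below v u) (rev (x :: rcons t z)) by rewrite rev_sorted.
  rewrite rev_cons rev_rcons /= => h.
  rewrite -map_rev -map_rcons path_map.
  by apply: sub_path h => u v; rewrite /below /sw /= andbC.
Qed.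

Section Squares.

Variable n : nat.
Implicit Types (F P : {set square n}).

Definition coords (x : square n) : point := (x.1 : nat, x.2 : nat).

Lemma coords_inj : injective coords.
Proof. by move=> [a b] [c d] [/val_inj-> /val_inj->]. Qed.

Definition pts P : pred point := fun q => q \in [seq coords x | x in P].

Lemma ptsP P q : reflect (exists2 x, x \in P & q = coords x) (pts P q).
Proof. exact: imageP. Qed.

Lemma pts_square P x : pts P (coords x) = (x \in P).
Proof. by rewrite /pts mem_image //; apply: coords_inj. Qed.

Lemma pts_transpose P q : pts (transpose P) q = pts P (q.2, q.1).
Proof.
apply/ptsP/ptsP => -[[a b] xP e].
  by move: xP; rewrite mem_transpose /= => xP; exists (b, a); rewrite ?e.
exists (b, a); first by rewrite mem_transpose.
by case: q e => q1 q2 /= [-> ->].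
Qed.

Lemma pts_bound P q : pts P q -> q.1 < n /\ q.2 < n.
Proof. by case/ptsP=> x _ ->; rewrite /= !ltn_ord. Qed.

Lemma placed_pts F P : is_placement F P -> placed (pts P).
Proof.
case/is_placementP=> _ h1 h2; split=> i j k /ptsP[x xP [ex1 ex2]] /ptsP[y yP [ey1 ey2]].
- have e : x = y by apply: h1 => //; apply: val_inj; rewrite /= -ex1 -ey1.
  by rewrite ex2 ey2 e.
- have e : x = y by apply: h2 => //; apply: val_inj; rewrite /= -ex2 -ey2.
  by rewrite ex1 ey1 e.
Qed.

Lemma down_closed_pts F : ferrers F -> down_closed (pts F).
Proof.
move=> hF; split=> i j /ptsP[[x1 x2] xF [/= e1 e2]].
  have lt : i < n by have := ltn_ord x1; lia.
  apply/ptsP; exists (Ordinal lt, x2); last by rewrite /coords /= -e2.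
  by apply: hF xF _ _ => //=; lia.
have lt : j < n by have := ltn_ord x2; lia.
apply/ptsP; exists (x1, Ordinal lt); last by rewrite /coords /= -e1.
by apply: hF xF _ _ => //=; lia.
Qed.

Lemma pts_lift P c : all (pts P) c ->
  exists2 t : seq (square n), all (fun x => x \in P) t & c = map coords t.
Proof.
elim: c => [|q c IH] /=; first by exists [::].
case/andP=> /ptsP[x xP ->] /IH[t tP ->]; exists (x :: t) => //=.
by rewrite xP.
Qed.

Lemma chain_bounds x s : path below x s ->
  all (fun w => (x.1 <= w.1 <= (last x s).1) && ((last x s).2 <= w.2 <= x.2)) (x :: s).
Proof.
elim: s x => [|y s IH] x /=; first by rewrite !leqnn.
move=> /andP[/andP[x1 x2] ys]; have /= /andP[/andP[h1 h2] h3] := IH y ys.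
apply/and3P; split; [lia|lia|].
by apply: sub_all h3 => w; lia.
Qed.

Lemma occurrence_chain k F P (s : k.-tuple (square n)) x t :
  occurrence F P s -> tval s = x :: t ->
  [/\ all (pts P) (map coords (x :: t)),
      path below (coords x) (map coords t) &
      pts F ((last (coords x) (map coords t)).1, (coords x).2)].
Proof.
case/and3P=> sP ss /existsP[a /existsP[b /andP[abF sab]]] e; rewrite e in sP ss sab.
split.
- by rewrite all_map; apply: sub_all sP => y yP; rewrite /= pts_square.
- by rewrite path_map.
- rewrite last_map -[(_, _)]/(coords ((last x t).1, x.2)) pts_square.
  apply: (subsetP abF); move/allP: sab => sab.
  by have := sab x (mem_head _ _); have := sab _ (mem_last x t); rewrite !inE /=; lia.
Qed.

Lemma chain_occurrence k F P (s : k.-tuple (square n)) x t : ferrers F ->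
  tval s = x :: t -> all (fun x => x \in P) s ->
  path below (coords x) (map coords t) ->
  pts F ((last (coords x) (map coords t)).1, (coords x).2) ->
  occurrence F P s.
Proof.
move=> hF e sP pt Fe; apply/and3P; split=> //; first by rewrite e; move: pt; rewrite path_map.
have bnd := chain_bounds pt.
rewrite last_map -[(_, _)]/(coords ((last x t).1, x.2)) pts_square in Fe.
(* The rectangle spanned by the chain lies in [F] because its upper right corner does. *)
apply/existsP; exists (x.1, (last x t).2); apply/existsP; exists ((last x t).1, x.2).
apply/andP; split.
  by apply/subsetP=> y; rewrite inE /= => y12; apply: hF Fe _ _ => /=; lia.
rewrite e; move: bnd; rewrite last_map -map_cons all_map; apply: sub_all => y.
by move=> h; rewrite inE; exact: h.
Qed.

Lemma no_chain_pts k F P : ferrers F -> ~~ has_occurrence k F P ->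
  no_chain (pts F) (pts P) k.
Proof.
move=> hF nocc x s sk As xs Fe.
have [t tP e] := pts_lift As.
have sz : size t == k by rewrite -sk e size_map.
case: t e tP sz => // y t [ex es] tP sz; move/negP: nocc; apply.
apply/existsP; exists (Tuple sz).
rewrite ex es in xs Fe.
exact: (@chain_occurrence k F P (Tuple sz) y t).
Qed.

Lemma lexi_lt (l l1 l2 : seq nat) a b : a < b ->
  ((l ++ b :: l1 : seqlexi nat) <= (l ++ a :: l2 : seqlexi nat))%O = false.
Proof.
move=> ab; elim: l => [|c l IH] /=; rewrite Order.SeqLexiOrder.Exports.lexi_cons.
  by apply/negP => /andP[]; rewrite leEnat leqNgt ab.
by rewrite Order.POrderTheory.lexx /= IH.
Qed.

End Squares.

Lemma cycle_rowsE n (x : square n) s :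
  map (@coords n) (cycle_rows (x :: s)) =
    rcons (shifts (map (@coords n) (x :: s)))
      ((last (coords x) (map (@coords n) s)).1, (coords x).2).
Proof.
rewrite /cycle_rows /rows /cols map_cons rot1_cons.
(* The row moved to the end must stay fixed while the head changes in the induction. *)
rewrite -[(coords x).2]/(nat_of_ord x.2); move: x.2 => r.
elim: s x => [|y s IH] x //=.
by congr (_ :: _); exact: IH.
Qed.

(** * The smallest occurrence as a tight chain *)

Section Smallest.

Variables (n k : nat) (F P : {set square n}) (s : k.-tuple (square n)).
Variables (x : square n) (t : seq (square n)).
Hypotheses (hF : ferrers F) (plP : is_placement F P).
Hypotheses (small : smallest_occurrence F P s) (sE : tval s = x :: t).

Let X := coords x.
Let S := map (@coords n) t.

(** [u ++ v] would be an occurrence that agrees with [s] on [u] and then has a lower row than [w],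
    hence lexicographically smaller. *)
Lemma smallest_prefix u w ws v : X :: S = u ++ w :: ws ->
  size (u ++ v) = k -> all (pts P) v -> sorted below (u ++ v) ->
  pts F ((last X (u ++ v)).1, (head X (u ++ v)).2) ->
  (head w v).2 < w.2 -> v != [::] -> False.
Proof.
move=> XS sv Pv uv Fuv lt v0; case/andP: small => occ /forallP min.
have [Xs _ _] := occurrence_chain occ sE.
have Pu : all (pts P) (u ++ v).
  by move: Xs; rewrite map_cons -/X -/S XS !all_cat Pv => /andP[-> _].
have [c cP e] := pts_lift Pu.
have sz : size c == k by rewrite -sv e size_map.
have := min (Tuple sz); rewrite (_ : occurrence F P _ = true) /=; last first.
  case: c cP e sz => [|y c] cP e sz; first by case: (u) e => [|? ?]; case: (v) v0.
  rewrite e /= in uv Fuv; exact: (@chain_occurrence n k F P (Tuple sz) y c).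
have rw (z : seq (square n)) : [seq val j | j <- rows z] = map snd (map (@coords n) z).
  by rewrite /rows -!map_comp.
rewrite /row_word !rw -e sE map_cons -/X -/S XS !map_cat /=.
case: v v0 lt {Pv sv uv Fuv Pu e} => //= z v _ lt.
by rewrite lexi_lt.
Qed.

Lemma smallest_low : no_chain (fun q => pts F q && (q.2 < X.2)) (pts P) k.
Proof.
move=> z v sv Pv zv /andP[/= Fv lt].
by apply: (@smallest_prefix [::] X S (z :: v)).
Qed.

Lemma smallest_tight : tight (pts P) (last X S).1 0 (X :: S).
Proof.
case/andP: (small) => occ _.
have [_ XS_path XSF] := occurrence_chain occ sE.
rewrite -/X -/S in XS_path XSF.
have sk : size (X :: S) = k by rewrite /= size_map -(size_tuple s) sE.
(* The column bound for the tail [w] starts just after the last point of the prefix [u], so that a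
   competing chain can be appended to [u]. *)
have main u w : X :: S = u ++ w ->
    tight (pts P) (last X S).1 (if u is a :: u' then (last a u').1.+1 else 0) w.
  elim: w u => [|w ws IH] u uw //; split; last first.
    have := IH (rcons u w); rewrite cat_rcons => /(_ uw).
    by case: u {uw} => [|a u] //=; rewrite last_rcons.
  move=> v sv Pv pv bv; apply: (@smallest_prefix u w ws v) => //.
  - by rewrite size_cat sv -size_cat -uw sk.
  - case: u uw bv => [|a u] uw bv //=.
    rewrite cat_path; have : path below a (u ++ w :: ws) by case: uw XS_path => -> ->.
    rewrite cat_path => /andP[-> /= /andP[/andP[_ h2] _]] /=.
    case: v bv pv {sv Pv} => //= z v /andP[/andP[/andP[h1 _] h3] _] ->.
    by rewrite andbT /below h1 (ltn_trans h3).
  - case: v bv sv {Pv pv} => [|z v] bv // _.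
    have /allP bv' := bv.
    have lastE : last X (u ++ z :: v) = last z v by rewrite last_cat.
    rewrite lastE.
    apply: (down_closed_le (down_closed_pts hF) XSF).
      by have /andP[/andP[_ h] _] := bv' _ (mem_last z v).
    have zw : z.2 < w.2 by have /andP[_] := bv' z (mem_head _ _).
    case: u uw {bv bv' lastE} => [|a u] [eX _]; last by rewrite eX leqnn.
    by move: zw; rewrite -eX => /ltnW.
  - by case: v bv sv {Pv pv} => //= z v /andP[/andP[_ ->]].
  - by case: v sv {Pv pv bv}.
exact: (main [::]).
Qed.

Lemma cycled_pts q : pts ((P :\: [set y in tval s]) :|: [set y in cycle_rows s]) q =
  cyc (pts P) (X :: S) q || (q == ((last X S).1, X.2)).
Proof.
have E : map (@coords n) (cycle_rows s) =
    rcons (shifts (X :: S)) ((last X S).1, X.2) by rewrite sE cycle_rowsE.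
rewrite /cyc orbAC [_ || (q == _)]orbC -in_cons -mem_rcons -E.
have memS y : (coords y \in X :: S) = (y \in tval s).
  rewrite sE; apply: (mem_map (f := @coords n) _ (x :: t)).
  exact: coords_inj.
apply/ptsP/orP => [[y]|[/mapP[y ys ->]|/andP[/ptsP[y yP ->]]]].
- rewrite in_setU in_setD !in_set => /orP[/andP[ys yP]|ys] ->.
    by right; rewrite pts_square yP memS.
  by left; rewrite map_f.
- by exists y; rewrite // !inE ys orbT.
- by rewrite memS => ys; exists y; rewrite // !inE ys yP.
Qed.

End Smallest.

Section Border.

Variables (n k : nat) (F : {set square n}).
Hypotheses (hk : 1 < k) (hF : ferrers F).

Lemma phi_border (P : placement F) :
  same_border k.-1 (pts F) (pts P) (pts (phi k P)).
Proof.
have plphi := is_placement_phi_set k (placementP P).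
rewrite /phi /=; move: plphi; rewrite /phi_set.
case: pickP => [s small|_ _]; last by [].
move=> pl2; have kk : k.-1.+1 = k by rewrite prednK // ltnW.
case sE: (tval s) (size_tuple s) => [|x t] /= sk; first by move: hk; rewrite -sk.
have [occ _] := andP small.
have [h1 h2 h3] := occurrence_chain occ sE.
apply: (@cycle_border k.-1 (pts F) (pts P) _ (coords x) (map (@coords n) t)) => //.
- by rewrite -ltnS kk.
- exact: down_closed_pts.
- exact: placed_pts (placementP P).
- by move: (placed_pts pl2); rewrite sE.
- by rewrite size_map -sk.
- exact: smallest_tight small sE.
- by rewrite kk; apply: (smallest_low hF small sE).
- by move=> q; rewrite -sE; apply: (cycled_pts P sE).
Qed.

Lemma phi_star_border (P : placement F) :
  same_border k.-1 (pts F) (pts P) (pts (phi_star hk P)).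
Proof.
rewrite /phi_star; case: ex_minnP => m _ _; elim: m => [|m IH] //.
by rewrite iterS; apply: same_border_trans IH (phi_border _).
Qed.

Lemma phi_star_no_chain (P : placement F) :
  no_chain (pts F) (pts (phi_star hk P)) k.
Proof.
apply: no_chain_pts => //; rewrite /phi_star; by case: ex_minnP.
Qed.

End Border.

Theorem mainTheorem2 (n k : nat) (hk : 1 < k) (F : {set square n})
    (hF : ferrers F) (P : placement F) :
  phi_star hk (inverse P) = inverse (phi_star hk P).
Proof.
have hF' := ferrers_transpose hF.
have k1 : k.-1.+1 = k by rewrite prednK // ltnW.
have swapE (Q : {set square n}) : pts (transpose Q) =1 (fun q => pts Q (q.2, q.1)).
  exact: pts_transpose.
(* Both placements have the border colours of the inverse of [P]: one by invariance on the
   transposed board, the other by transposing the invariance for [P]. *)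
have brd : same_border k.-1 (pts (transpose F)) (pts (phi_star hk (inverse P)))
    (pts (inverse (phi_star hk P))).
  move=> i j Fij.
  have [u a] := phi_star_border hk hF' (inverse P) Fij.
  have Fij' := Fij; rewrite swapE in Fij'.
  have [u' a'] := same_border_swap (phi_star_border hk hF P) Fij'.
  by split=> nF; rewrite ?u ?a // ?(cup_ext _ _ _ (swapE _)) ?(cacross_ext _ _ _ (swapE _));
     [apply: u'|apply: a']; rewrite -swapE.
have noc : no_chain (pts (transpose F)) (pts (inverse (phi_star hk P))) k.-1.+1.
  rewrite k1 => x s sk As xs Fe.
  have nc := no_chain_swap (@phi_star_no_chain n k F hk hF P).
  apply: (nc x s) => //; last by rewrite -swapE.
  by apply: sub_all As => q; rewrite swapE.
have E := border_inj _ (down_closed_pts hF') (placed_pts (placementP _))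
  (placed_pts (placementP _)) (@pts_bound n _) _ noc brd.
apply: val_inj; apply/setP => x /=.
have [xF|xF] := boolP (x \in transpose F).
  rewrite -!pts_square; apply: E; rewrite ?pts_square //.
    by rewrite -ltnS k1.
  by rewrite k1; apply: phi_star_no_chain.
have sub (Q : placement (transpose F)) : x \in squares Q = false.
  apply/negP => xQ; have [/subsetP/(_ x xQ)] := is_placementP _ _ (placementP Q).
  by rewrite (negbTE xF).
by rewrite (sub (phi_star hk (inverse P))) (sub (inverse (phi_star hk P))).
Qed.
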